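(* Let $n\ge1$ and $\sigma>0$ with $n=2\sigma$, and let $w:\mathbb{R}^n\setminus\{0\}\to\mathbb{R}$ be smooth, homogeneous of degree $\sigma$, of maximal rank (as defined in the context), with $w(\xi)>0$ for $\xi\ne0$. Let $a\in\mathcal{C}^{n+1}(\mathbb{R}^n\setminus\{0\})$ with $a(\xi)>0$ for $\xi\neq0$, and assume that for some $\theta_1\in(0,\sigma)$, $a_1>0$, $C>0$, $$a(\xi)\ge a_1|\xi|^{\theta_1},\qquad|\partial_\xi^\gamma a(\xi)|\le C|\xi|^{\theta_1-|\gamma|},\quad|\gamma|\le n+1,$$ out of some compact set of $\mathbb{R}^n$. Let $\chi\in\mathcal{C}_c^\infty(\mathbb{R}^n)$ with $\chi=1$ in a neighborhood of the origin and $T_\chi f=\mathscr{F}^{-1}(\chi\hat f)$. For $u_1\in L^1(\mathbb{R}^n)$ let $u$ be the solution of $u_{tt}+L_{w^2}u+Au_t=0$, $u(0,\cdot)=0$, $u_t(0,\cdot)=u_1$, given by the formula in the context. Then there are constants $C',c>0$, independent of $t$ and $u_1$, such that $$\|(\mathrm{Id}-T_\chi)u(t,\cdot)\|_{L^2}\le C'\big(1+(-\log t)_+\big)^{\frac12}e^{-ct}\,\|u_1\|_{L^1},\quad t>0.$$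
   Context: $w$ has maximal rank if its Hessian matrix $H_w(\xi)$ satisfies, for all $\xi\neq0$: $\det H_w(\xi)\ne0$ when $\sigma\ne1$, and $\operatorname{rank}H_w(\xi)=n-1$ when $\sigma=1$. $(r)_+=\max\{r,0\}$. Hats and $\mathscr{F}$ denote Fourier transform with respect to $x\in\mathbb{R}^n$; $L_{w^2}u=\mathscr{F}^{-1}(w(\xi)^2\hat u)$, $Au=\mathscr{F}^{-1}(a(\xi)\hat u)$, $\mathrm{sinc}\,\rho=\rho^{-1}\sin\rho$. Solution formula: $\hat u$ solves $\hat u_{tt}+w(\xi)^2\hat u+a(\xi)\hat u_t=0$, $\hat u(0,\xi)=0$, $\hat u_t(0,\xi)=\hat u_1(\xi)$, i.e. if $a(\xi)^2<4w(\xi)^2$, $$\hat u(t,\xi)=e^{-a(\xi)t/2}\,t\,\mathrm{sinc}\big(tw(\xi)\sqrt{1-\tilde a(\xi)}\big)\hat u_1(\xi),\qquad\tilde a(\xi)=\frac{a(\xi)^2}{4w(\xi)^2},$$ and if $a(\xi)^2\ge4w(\xi)^2$, $$\hat u(t,\xi)=\frac{e^{\lambda_+t}-e^{\lambda_-t}}{\lambda_+-\lambda_-}\hat u_1(\xi),\qquad\lambda_\pm=\frac{-a(\xi)\pm\sqrt{a(\xi)^2-4w(\xi)^2}}2,$$ intended as its limit $te^{-w(\xi)t}\hat u_1(\xi)$ when $a(\xi)=2w(\xi)$. *)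

(* Defs.v *)
From HB Require Import structures.
From mathcomp Require Import all_boot all_order all_algebra.
From mathcomp Require Import all_classical all_reals all_analysis.
From mathcomp Require Import complex.

Set Implicit Arguments.
Unset Strict Implicit.
Unset Printing Implicit Defensive.
Import Order.TTheory GRing.Theory Num.Theory.
Import numFieldNormedType.Exports.
Local Open Scope classical_set_scope.
Local Open Scope ring_scope.
Local Open Scope complex_scope.

(* The space R^n is 'rV[R]_n. Its sigma-algebra is the one generated by the n
   coordinates, i.e. the Borel sigma-algebra. *)

Definition rV_display : measure_display.
Proof. exact. Qed.

Section rV_measurable.
Context {R : realType} (n : nat).

Definition rV_coor (i : 'I_n) (x : 'rV[R]_n) : measurableTypeR R := x ord0 i.

Let rV_set0 : g_sigma_preimage rV_coor set0.
Proof. exact: sigma_algebra0. Qed.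

Let rV_setC A : g_sigma_preimage rV_coor A -> g_sigma_preimage rV_coor (~` A).
Proof. exact: sigma_algebraC. Qed.

Let rV_bigcup (F : (set 'rV[R]_n)^nat) :
  (forall i, g_sigma_preimage rV_coor (F i)) ->
  g_sigma_preimage rV_coor (\bigcup_i (F i)).
Proof. exact: sigma_algebra_bigcup. Qed.

HB.instance Definition _ := @isMeasurable.Build rV_display
  'rV[R]_n (g_sigma_preimage rV_coor) rV_set0 rV_setC rV_bigcup.

Lemma measurable_rV_coor (i : 'I_n) : measurable_fun setT (rV_coor i).
Proof.
move=> _ Y mY; rewrite setTI; apply: sub_sigma_algebra => /=.
rewrite -bigcup_seq/=; exists i => /=; first by rewrite mem_index_enum.
by exists Y => //; rewrite setTI.
Qed.

Lemma measurable_fun_rVP d (T : measurableType d) (f : T -> 'rV[R]_n) :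
  (forall i, measurable_fun setT (rV_coor i \o f)) -> measurable_fun setT f.
Proof.
move=> mf _ Y mY; rewrite setTI.
suff : g_sigma_preimage rV_coor `<=` [set B | measurable (f @^-1` B)].
  exact.
apply: smallest_sub.
  split => /=.
  - by rewrite preimage_set0; exact: measurable0.
  - by move=> B mB; rewrite setTD preimage_setC; exact: measurableC.
  - by move=> F mF; rewrite preimage_bigcup; exact: bigcup_measurable.
rewrite -bigcup_seq; apply: bigcup_sub => i _ _ [B mB <-] /=.
rewrite setTI -comp_preimage -[X in measurable X]setTI.
exact: (mf i).
Qed.

End rV_measurable.

Section rV_lebesgue.
Context {R : realType}.
Local Open Scope ereal_scope.

Definition cons_rV (n : nat) (p : measurableTypeR R * 'rV[R]_n) :
    'rV[R]_n.+1 :=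
  \row_(i < n.+1) (if unlift ord0 i is Some j then p.2 ord0 j else p.1).

Lemma measurable_cons_rV (n : nat) : measurable_fun setT (@cons_rV n).
Proof.
apply: measurable_fun_rVP => i.
have [j ij|i0] := unliftP ord0 i.
- rewrite (_ : _ \o _ = rV_coor j \o snd).
    exact: (measurableT_comp (@measurable_rV_coor R n j) measurable_snd).
  by apply/funext => p /=; rewrite /rV_coor mxE ij liftK.
- rewrite (_ : _ \o _ = fst); first exact: measurable_fst.
  by apply/funext => p /=; rewrite /rV_coor mxE i0 unlift_none.
Qed.

Section lebesgue_rV_succ.
Variables (n : nat) (mu : {sigma_finite_measure set 'rV[R]_n -> \bar R}).

Definition lebesgue_rV_succ : set 'rV[R]_n.+1 -> \bar R :=
  pushforward (lebesgue_measure \x mu) (@cons_rV n).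

Let succ0 : lebesgue_rV_succ set0 = 0.
Proof. by rewrite /lebesgue_rV_succ /pushforward preimage_set0 measure0. Qed.

Let succ_ge0 A : 0 <= lebesgue_rV_succ A.
Proof. by rewrite /lebesgue_rV_succ /pushforward; exact: measure_ge0. Qed.

Let succ_sigma_additive : semi_sigma_additive lebesgue_rV_succ.
Proof.
move=> F mF tF mUF; rewrite /lebesgue_rV_succ /pushforward preimage_bigcup.
have mc B : measurable B -> measurable (@cons_rV n @^-1` B).
  by move=> mB; rewrite -[X in measurable X]setTI; exact: measurable_cons_rV.
apply: measure_semi_sigma_additive.
- by move=> k; exact: mc.
- apply/trivIsetP => /= i j _ _ ij; rewrite -preimage_setI.
  by move/trivIsetP : tF => /(_ _ _ _ _ ij) ->//; rewrite preimage_set0.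
- by rewrite -preimage_bigcup; exact: mc.
Qed.

HB.instance Definition _ := isMeasure.Build _ _ _
  lebesgue_rV_succ succ0 succ_ge0 succ_sigma_additive.

Lemma lebesgue_rV_succE (A : set R) (B : set 'rV[R]_n) :
  measurable (A : set (measurableTypeR R)) -> measurable B ->
  lebesgue_rV_succ [set x | A (x ord0 ord0) /\
                            B (\row_j x ord0 (lift ord0 j))] =
  lebesgue_measure (A : set (measurableTypeR R)) * mu B.
Proof.
move=> mA mB; rewrite -product_measure1E// /lebesgue_rV_succ /pushforward.
congr ((_ \x _) _); apply/seteqP; split => -[x v] /=;
  rewrite mxE unlift_none (_ : \row_j _ = v)//;
  by apply/rowP => j; rewrite !mxE liftK.
Qed.

Let succ_sigma_finite : sigma_finite setT lebesgue_rV_succ.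
Proof.
have /sigma_finiteP[F [TF ndF Foo]] := sigma_finiteT (@lebesgue_measure R).
have /sigma_finiteP[G [TG ndG Goo]] := sigma_finiteT mu.
exists (fun k => [set x : 'rV[R]_n.+1 | F k (x ord0 ord0) /\
                          G k (\row_j x ord0 (lift ord0 j))]).
  apply/seteqP; split => // x _.
  have [i _ Fi] : (\bigcup_i F i) (x ord0 ord0) by rewrite -TF.
  have [j _ Gj] : (\bigcup_i G i) (\row_j x ord0 (lift ord0 j)) by rewrite -TG.
  exists (maxn i j) => //=; split.
  - by move: Fi; exact/subsetPset/ndF/leq_maxl.
  - by move: Gj; exact/subsetPset/ndG/leq_maxr.
move=> k; have [mF Fk] := Foo k; have [mG Gk] := Goo k; split.
  apply: measurableI.
    by rewrite -[X in measurable X]setTI; exact: (measurable_rV_coor ord0).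
  rewrite -[X in measurable X]setTI.
  have mt : measurable_fun setT
      (fun x : 'rV[R]_n.+1 => \row_(j < n) x ord0 (lift ord0 j)).
    apply: measurable_fun_rVP => i.
    rewrite (_ : _ \o _ = rV_coor (lift ord0 i)).
      exact: measurable_rV_coor.
    by apply/funext => x /=; rewrite /rV_coor mxE.
  exact: mt.
by rewrite lebesgue_rV_succE// lte_mul_pinfty// ge0_fin_numE.
Qed.

HB.instance Definition _ := Measure_isSigmaFinite.Build _ _ _
  lebesgue_rV_succ succ_sigma_finite.

End lebesgue_rV_succ.

(* Lebesgue measure on R^n as the n-fold product of Lebesgue measure on R. *)
Fixpoint lebesgue_rV (n : nat) : {sigma_finite_measure set 'rV[R]_n -> \bar R} :=
  match n with
  | 0 => \d_ (0%R : 'rV[R]_0)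
  | m.+1 => lebesgue_rV_succ (lebesgue_rV m)
  end.

End rV_lebesgue.

Section partial_derivatives.
Context {R : realType} {n : nat}.
Implicit Types (f : 'rV[R]_n -> R) (U : set 'rV[R]_n) (g : 'I_n -> nat).

Definition partial (i : 'I_n) f : 'rV[R]_n -> R :=
  fun x => 'D_(delta_mx ord0 i) f x.

Definition mi_order g : nat := (\sum_i g i)%N.

Definition mi_partial g f : 'rV[R]_n -> R :=
  foldr (fun i h => iter (g i) (partial i) h) f (enum 'I_n).

(* f is of class C^k on U; U is meant to be open, so that the values of f
   outside U play no role. *)
Fixpoint Ck_on (k : nat) U f : Prop :=
  (forall x, U x -> {for x, continuous f}) /\
  match k with
  | 0 => True
  | k'.+1 => forall i : 'I_n,
      (forall x, U x -> derivable f x (delta_mx ord0 i)) /\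
      Ck_on k' U (partial i f)
  end.

Definition smooth_on U f : Prop := forall k, Ck_on k U f.

Definition hessian f (x : 'rV[R]_n) : 'M[R]_n :=
  \matrix_(i, j) partial i (partial j f) x.

Definition dotv (x y : 'rV[R]_n) : R := \sum_i x ord0 i * y ord0 i.

(* The Euclidean norm; `|x| is the sup norm on 'rV[R]_n. *)
Definition enorm (x : 'rV[R]_n) : R := Num.sqrt (dotv x x).

Definition punctured : set 'rV[R]_n := [set x | x != 0].

End partial_derivatives.

Definition maximal_rank {R : realType} {n : nat} (sigma : R)
    (w : 'rV[R]_n -> R) : Prop :=
  forall xi, xi != 0 ->
    (sigma != 1 -> \det (hessian w xi) != 0) /\
    (sigma = 1 -> \rank (hessian w xi) = (n - 1)%N).

Section fourier.
Context {R : realType} {n : nat}.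
Local Notation mu := (@lebesgue_rV R n).
Implicit Types (f g : 'rV[R]_n -> R[i]).

Definition csmooth f : Prop :=
  smooth_on setT (fun x => complex.Re (f x)) /\
  smooth_on setT (fun x => complex.Im (f x)).

Definition test_function f : Prop :=
  csmooth f /\
  exists K : set 'rV[R]_n, compact K /\ forall x, ~ K x -> f x = 0.

Definition rapidly_decreasing (f : 'rV[R]_n -> R) : Prop :=
  forall (N : nat) (g : 'I_n -> nat), exists M : R,
    forall x, enorm x ^+ N * `|mi_partial g f x| <= M.

Definition schwartz f : Prop :=
  [/\ csmooth f, rapidly_decreasing (fun x => complex.Re (f x)) &
      rapidly_decreasing (fun x => complex.Im (f x))].

Definition cmeasurable f : Prop :=
  measurable_fun setT (fun x => complex.Re (f x)) /\
  measurable_fun setT (fun x => complex.Im (f x)).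

Definition cintegrable f : Prop :=
  mu.-integrable setT (fun x => (complex.Re (f x))%:E) /\
  mu.-integrable setT (fun x => (complex.Im (f x))%:E).

Definition cintegral f : R[i] :=
  (\int[mu]_x complex.Re (f x)) +i* (\int[mu]_x complex.Im (f x)).

Definition Lpnorm (p : \bar R) f : \bar R :=
  'N[mu]_p[(fun x => (Normc.normc (f x))%:E)]%E.

Definition cis (theta : R) : R[i] := cos theta +i* sin theta.

Definition fourier f : 'rV[R]_n -> R[i] :=
  fun xi => cintegral (fun x => cis (- dotv x xi) * f x).

Definition inv_fourier f : 'rV[R]_n -> R[i] :=
  fun x => (((2 * pi) ^+ n)^-1)%:C * cintegral (fun xi => cis (dotv x xi) * f xi).

(* Tempered distributions are represented by their values on Schwartz
   functions; only these values matter. *)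
Definition distribution := ('rV[R]_n -> R[i]) -> R[i].

(* The inverse Fourier transform, in the sense of tempered distributions, of
   the function g: <F^-1 g, phi> = <g, F^-1 phi>. *)
Definition inv_fourier_distr g : distribution :=
  fun phi => cintegral (fun xi => g xi * inv_fourier phi xi).

(* T_chi f = F^-1 (chi * F f), in terms of the Fourier transform fhat of f. *)
Definition cutoff_distr (chi fhat : 'rV[R]_n -> R[i]) : distribution :=
  inv_fourier_distr (fun xi => chi xi * fhat xi).

(* The L^2 norm of a distribution: the norm of the function which represents
   it (unique up to null sets among square integrable functions), and +oo if
   no square integrable function does. *)
Definition L2norm_distr (T : distribution) : \bar R :=
  ereal_inf [set Lpnorm 2%:E v | v in [set v : 'rV[R]_n -> R[i] |
    [/\ cmeasurable v, (Lpnorm 2%:E v < +oo)%E &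
        forall phi, schwartz phi ->
          T phi = cintegral (fun x => v x * phi x)]]].

End fourier.

Section damped_evolution.
Context {R : realType} {n : nat}.
Variables (w a : 'rV[R]_n -> R).

Definition sinc (r : R) : R := r^-1 * sin r.

Definition multiplier (t : R) (xi : 'rV[R]_n) : R :=
  if a xi ^+ 2 < 4 * w xi ^+ 2 then
    let ta := a xi ^+ 2 / (4 * w xi ^+ 2) in
    expR (- (a xi * t / 2)) * (t * sinc (t * w xi * Num.sqrt (1 - ta)))
  else if a xi == 2 * w xi then t * expR (- (w xi * t))
  else
    let s := Num.sqrt (a xi ^+ 2 - 4 * w xi ^+ 2) in
    let lp := (- a xi + s) / 2 in
    let lm := (- a xi - s) / 2 in
    (expR (lp * t) - expR (lm * t)) / (lp - lm).

(* The Fourier transform of the solution at time t. *)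
Definition solution_hat (u1 : 'rV[R]_n -> R[i]) (t : R) : 'rV[R]_n -> R[i] :=
  fun xi => (multiplier t xi)%:C * fourier u1 xi.

Definition solution (u1 : 'rV[R]_n -> R[i]) (t : R) : distribution :=
  inv_fourier_distr (solution_hat u1 t).

End damped_evolution.

(* Main.v *)
Require Import Defs.
From mathcomp Require Import all_boot all_order all_algebra.
From mathcomp Require Import all_classical all_reals all_analysis.
From mathcomp Require Import measurable_realfun.
From mathcomp Require Import complex.
From mathcomp Require Import ring lra.
Set Implicit Arguments.
Unset Strict Implicit.
Unset Printing Implicit Defensive.
Import Order.TTheory GRing.Theory Num.Theory.
Import numFieldNormedType.Exports.
Local Open Scope classical_set_scope.
Local Open Scope ring_scope.

(** Write m(t, xi) for [multiplier w a t xi], chi for the cutoff and U for the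
    Fourier transform of the datum. The distribution to be bounded is the
    inverse Fourier transform of g = (1 - chi) m(t, .) U, and U is bounded by
    a constant times the L^1 norm of the datum.

    For fixed t > 0 the damping makes m(t, .) decay like
    exp(- (a1/2) t |xi|^theta1), so that g is integrable
    ([integrable_multiplier]). Its inverse transform is then a function v,
    which represents the distribution by Fubini alone
    ([inv_fourier_pairing]). Hence it is enough to bound the L^2 norm of v by
    that of g ([inv_fourier_sqn_le]), and then to integrate
    |(1 - chi) m(t, .)|^2 ([cutoff_multiplier_integral]).

    The L^2 bound is the easy half of the Plancherel theorem
    ([bessel_inequality]). For h integrable, multiply the squared transform
    of h by the weight exp(- e (|x_1| + ... + |x_n|)). Integrating in x turns
    the square into a double integral of h(xi) h(eta) against the Fourier
    transform of the weight at xi - eta. That transform is a product of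
    Poisson kernels: it is nonnegative and of total mass (2 pi)^n for every
    e, so that Schur's test bounds the double integral by (2 pi)^n times the
    integral of h^2. Monotone convergence as e tends to 0 removes the weight.

    For the remaining integral, 1 - chi vanishes near the origin. On a compact
    annulus w and a are bounded below, and both regimes of the solution
    formula give |m| <= t exp(- d t) ([multiplier_le]). For |xi| large,
    theta1 < sigma puts xi in the oscillating regime a < w, where
    |m|^2 <= 2 exp(- a t) / w^2 ([multiplier_sqr_le]). There w^2 is at least
    a multiple of |xi|^(2 sigma) = |xi|^n, which cancels the volume of a
    dyadic shell, so that the k-th shell contributes a multiple of
    exp(- a1 2^(k theta1) t). About log (1/t) shells satisfy
    2^(k theta1) t <= 1, and the later ones sum up to a bounded quantity
    ([dyadic_exp_sum]): this is the logarithm of the statement. *)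

(** * Borel sets and Lebesgue measure on row vectors *)

Section RowVectorMeasure.
Context {R : realType}.
Implicit Types n : nat.

Lemma ge0_integral_rV_succ n (f : 'rV[R]_n.+1 -> \bar R) :
  measurable_fun setT f -> (forall x, 0 <= f x)%E ->
  (\int[lebesgue_rV n.+1]_x f x =
   \int[lebesgue_measure]_s \int[lebesgue_rV n]_v f (cons_rV (s, v)))%E.
Proof.
move=> mf f0.
rewrite [LHS](ge0_integral_pushforward (@measurable_cons_rV R n)
  (lebesgue_measure \x lebesgue_rV n)%E)//.
rewrite preimage_setT fubini_tonelli1//.
exact: measurableT_comp mf (@measurable_cons_rV R n).
by move=> x; exact: f0.
Qed.

Lemma cons_rV0 n (s : R) (v : 'rV[R]_n) : cons_rV (s, v) ord0 ord0 = s.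
Proof. by rewrite mxE unlift_none. Qed.

Lemma cons_rVS n (s : R) (v : 'rV[R]_n) i :
  cons_rV (s, v) ord0 (lift ord0 i) = v ord0 i.
Proof. by rewrite mxE liftK. Qed.

Lemma dotv_cons n (s : R) (v : 'rV[R]_n) z :
  dotv (cons_rV (s, v)) z =
  s * z ord0 ord0 + dotv v (\row_j z ord0 (lift ord0 j)).
Proof.
rewrite /dotv big_ord_recl cons_rV0; congr (_ + _).
by apply: eq_bigr => i _; rewrite cons_rVS mxE.
Qed.

Lemma measurable_dotv d (T : measurableType d) n (f g : T -> 'rV[R]_n) :
  measurable_fun setT f -> measurable_fun setT g ->
  measurable_fun setT (fun x => dotv (f x) (g x)).
Proof.
move=> mf mg; apply: measurable_sum => i; apply: measurable_funM.
- exact: measurableT_comp (@measurable_rV_coor R n i) mf.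
- exact: measurableT_comp (@measurable_rV_coor R n i) mg.
Qed.

Lemma measurable_rV_entry n (i : 'I_n) :
  measurable_fun setT (fun x : 'rV[R]_n => x ord0 i).
Proof. exact: measurable_rV_coor. Qed.

Lemma measurable_forall_coord n (A : 'I_n -> set R) :
  (forall i, measurable (A i)) ->
  measurable [set x : 'rV[R]_n | forall i, A i (x ord0 i)].
Proof.
move=> mA; rewrite (_ : mkset _ =
    \big[setI/setT]_(i <- enum 'I_n) ((fun x : 'rV[R]_n =>
      x ord0 i) @^-1` A i)).
  apply: big_ind => //; first by move=> *; exact: measurableI.
  by move=> i _; rewrite -[X in measurable X]setTI; exact: measurable_rV_entry.
rewrite -bigcap_seq; apply/seteqP; split => x /= Ax i.
- by move=> _; exact: Ax.
- by apply: Ax; rewrite /= mem_enum.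
Qed.

Lemma measurable_sup_cube n (r : R) :
  measurable [set x : 'rV[R]_n | forall i, `|x ord0 i| <= r].
Proof.
apply: (@measurable_forall_coord n (fun=> [set y : R | `|y| <= r])) => _.
rewrite (_ : mkset _ = [set` `[- r, r]]); first exact: measurable_itv.
by apply/seteqP; split => y /=; rewrite in_itv /= ler_norml.
Qed.

Lemma lebesgue_sup_cube n (r : R) : 0 <= r ->
  lebesgue_rV n [set x : 'rV[R]_n | forall i, `|x ord0 i| <= r] =
  ((2 * r) ^+ n)%:E.
Proof.
move=> r0; elim: n => [|n IH].
  by rewrite /= diracE mem_set //= => -[].
rewrite (_ : mkset _ = [set x : 'rV[R]_n.+1 | [set y :
  R | `|y| <= r] (x ord0 ord0) /\
   [set x : 'rV[R]_n | forall i,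
     `|x ord0 i| <= r] (\row_j x ord0 (lift ord0 j))]).
  rewrite [LHS](@lebesgue_rV_succE R n (lebesgue_rV n) [set y : R | `|y| <= r]
    [set x : 'rV[R]_n | forall i, `|x ord0 i| <= r])//;
    last exact: measurable_sup_cube.
    rewrite (_ : mkset _ = [set` `[- r, r]]).
      rewrite lebesgue_measure_itv/= lte_fin.
      case: ltP => [rr|rr].
        by rewrite [X in (_ * X)%E = _]IH -EFinB -EFinM exprS opprK mulr_natl
          mulr2n.
      have -> : r = 0 by lra.
      by rewrite mul0e mulr0 expr0n.
    by apply/seteqP; split => y /=; rewrite in_itv /= ler_norml.
  rewrite (_ : mkset _ = [set` `[- r, r]]); first exact: measurable_itv.
  by apply/seteqP; split => y /=; rewrite in_itv /= ler_norml.
apply/seteqP; split => x /=.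
  by move=> xr; split => // i; rewrite mxE.
move=> [x0 xS] i; have [j ->|->//] := unliftP ord0 i.
by have := xS j; rewrite mxE.
Qed.

Lemma normr_rV_le n (x : 'rV[R]_n) (r : R) : 0 <= r ->
  (`|x| <= r) <-> (forall i, `|x ord0 i| <= r).
Proof.
move=> r0; rewrite [X in X <= _]mx_normrE; split => [/bigmax_leP[_ xr] i|xr].
  exact: (xr (ord0, i)).
by apply/bigmax_leP; split => // -[i j] _; rewrite (ord1 i).
Qed.

(** Boxes with rational corners form a countable base of the topology, so that
    an open set is a countable union of products of intervals. *)
Lemma open_measurable_rV n (U : set 'rV[R]_n) : open U -> measurable U.
Proof.
move=> oU.
pose box (c : 'rV[rat]_n * 'rV[rat]_n) := [set x : 'rV[R]_n |
  forall i, x ord0 i \in `]ratr (c.1 ord0 i), ratr (c.2 ord0 i)[ ].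
have mbox c : measurable (box c).
  exact: (@measurable_forall_coord n (fun i =>
    [set` `]ratr (c.1 ord0 i), ratr (c.2 ord0 i)[])).
rewrite (_ : U = \bigcup_(c in [set: 'rV[rat]_n * 'rV[rat]_n])
    (if `[< box c `<=` U >] then box c else set0)); last first.
  apply/seteqP; split => [x Ux|x [c _]]; last by case: asboolP => // cU /cU.
  have /nbhs_ballP[e /= e0 xeU] : nbhs x U by exact: open_nbhs_nbhs.
  have /choice[p px] i : exists p :
    rat, ratr p \in `](x ord0 i - e), (x ord0 i)[.
    by apply: rat_in_itvoo; rewrite ltrBlDr ltrDl.
  have /choice[q qx] i : exists p :
    rat, ratr p \in `](x ord0 i), (x ord0 i + e)[.
    by apply: rat_in_itvoo; rewrite ltrDl.
  exists (\row_i p i, \row_i q i) => //.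
  case: asboolP => [_|[]] /=.
    move=> i; rewrite !mxE in_itv /=.
    by move: (px i) (qx i); rewrite !in_itv /= => /andP[_ ->] /andP[-> _].
  move=> y /= yb; apply: xeU; split => // i j.
  rewrite (ord1 i) /ball /=; move: (yb j) (px j) (qx j);
    rewrite !mxE !in_itv /=.
  move=> /andP[? ?] /andP[? ?] /andP[? ?]; rewrite ltr_norml; apply/andP;
    split; lra.
apply: countable_bigcupT_measurable => [|c]; first exact: countableP.
by case: asboolP => // _; exact: measurable0.
Qed.

(** Measurability, unlike continuity, is insensitive to the single point where
    the symbols may be singular. *)
Lemma measurable_punctured_continuous n (f : 'rV[R]_n -> R) :
  (forall x, x != 0 -> {for x, continuous f}) -> measurable_fun setT f.
Proof.
move=> cf; apply: (measurability _ (RGenOInfty.measurableE R)) =>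
  _ /= [_ [r ->] <-].
rewrite setTI.
have o0 : open (~` [set (0 : 'rV[R]_n)]).
  by apply: closed_openC; exact: (accessible_closed_set1
    (hausdorff_accessible (@norm_hausdorff _ _))).
have m0 : measurable [set (0 : 'rV[R]_n)].
  by rewrite -[X in measurable X]setCK; apply: measurableC;
    exact: open_measurable_rV.
set S := (X in measurable X).
have mS1 : measurable (S `&` [set x | x != 0]).
  apply: open_measurable_rV; rewrite openE => x [/= fx x0].
  rewrite /interior; near=> y; split; near: y.
    have rf : r < f x by move: fx; rewrite /S /= in_itv /= andbT.
    have := cf _ x0; move=> /(_ [set` `]r, +oo[]); apply.
    by apply: open_nbhs_nbhs; split => //; exact: interval_open.
  by apply: open_nbhs_nbhs; split => //;
    rewrite (_ : mkset _ = ~` [set (0 : 'rV[R]_n)]) //;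
    apply/seteqP; split => z /=; [move/eqP|move=> /eqP].
rewrite (_ : S = (S `&` [set x | x != 0]) `|` (S `&` [set 0])).
  apply: measurableU => //.
  have [S0|S0] := pselect (S 0).
    by rewrite (_ : S `&` _ = [set 0]) //; apply/setIidPr => _ ->.
  by rewrite (_ : S `&` _ = set0) // -subset0 => x /= [Sx x0]; apply: S0;
    rewrite -x0.
apply/seteqP; split => x /=; last by move=> [[]|[]].
by move=> Sx; have [x0|x0] := eqVneq x 0; [right|left].
Unshelve. all: by end_near. Qed.

Lemma measurable_continuous_rV n (f : 'rV[R]_n -> R) :
  (forall x, {for x, continuous f}) -> measurable_fun setT f.
Proof. by move=> cf; apply: measurable_punctured_continuous => x _. Qed.

End RowVectorMeasure.

(** * One-dimensional integrals *)

Section ExponentialWeight.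
Context {R : realType}.
Local Notation leb := (@lebesgue_measure R).

(** Folding the line at 0 avoids the point where the exponential weight fails
    to be differentiable. *)
Lemma ge0_integral_fold (f : R -> R) : (forall x, 0 <= f x) -> continuous f ->
  (\int[leb]_x (f x)%:E = \int[leb]_(x in `[0%R, +oo[) (f x)%:E +
                          \int[leb]_(x in `[0%R, +oo[) (f (- x))%:E)%E.
Proof.
move=> f0 cf.
have mf : measurable_fun setT f by exact: continuous_measurable_fun.
rewrite -(setUv [set` Interval (BLeft (0:R)) +oo%O]) ge0_integral_setU//=;
  last 4 first.
- exact: measurableC.
- by apply/measurable_EFinP; rewrite setUv.
- by move=> x _; rewrite lee_fin.
- exact/disj_setPCl.
congr (_ + _)%E.
rewrite setCitvr integral_itv_bndo_bndc;
  last exact/measurable_EFinP/measurable_funTS.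
rewrite -{1}oppr0 ge0_integration_by_substitutionNy//.
exact: continuous_subspaceT.
Qed.

(** The summand 1 makes the integrand nonnegative, so that the fundamental
    theorem of calculus on a half-line applies to it. *)
Lemma halfline_exp_cos (e z b : R) : 0 < e ->
  (\int[leb]_(x in `[0%R, +oo[) (expR (- (e * x)) * (1 + cos (x * z + b)))%:E =
   (e^-1 + (e * cos b - z * sin b) / (e ^+ 2 + z ^+ 2))%:E)%E.
Proof.
move=> e0; have ez : e ^+ 2 + z ^+ 2 != 0.
  by rewrite gt_eqF// ltr_pwDl ?exprn_gt0 ?sqr_ge0.
pose D := e ^+ 2 + z ^+ 2.
(* a primitive; it tends to 0 at infinity *)
pose F (x : R) := expR (- (e * x)) *
  (- e^-1 + D^-1 * (- e * cos (x * z + b) + z * sin (x * z + b))).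
pose f (x : R) := expR (- (e * x)) * (1 + cos (x * z + b)).
have dF (x : R) : is_derive x 1 F (f x).
  rewrite /F; apply: is_derive_eq.
  rewrite /f /GRing.scale /= !mulr1 !mulr0 !addr0 ?add0r.
  rewrite /D; set c := cos _; set s := sin _; set E := expR _.
  by field; rewrite ez gt_eqF.
have cf : continuous f.
  move=> x; apply: differentiable_continuous; apply/derivable1_diffP.
  exact: ex_derive.
rewrite (ge0_continuous_FTC2y (F := F) (l := 0)).
- rewrite /F mulr0 mul0r !add0r oppr0 expR0 /D; congr EFin; field.
  by rewrite ez gt_eqF.
- by move=> x _; rewrite mulr_ge0 ?expR_ge0//; have := cos_geN1 (x * z + b);
    lra.
- exact: continuous_subspaceT.
- pose M := e^-1 + D^-1 * (e + `|z|).
  have M0 : 0 <= M.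
    by rewrite addr_ge0 ?invr_ge0 ?(ltW e0)// mulr_ge0 ?addr_ge0 ?invr_ge0
      ?(ltW e0)// addr_ge0 ?sqr_ge0.
  have FM x : `|F x| <= M * expR (- (e * x)).
    rewrite normrM ger0_norm ?expR_ge0// mulrC ler_wpM2r ?expR_ge0//.
    apply: (le_trans (ler_normD _ _)); rewrite normrN; apply: lerD;
      first by rewrite ger0_norm ?invr_ge0 ?(ltW e0).
    have D0 : 0 <= D^-1 by rewrite invr_ge0 addr_ge0 ?sqr_ge0.
    rewrite normrM (ger0_norm D0); apply: ler_wpM2l => //.
    apply: (le_trans (ler_normD _ _));
      rewrite !normrM normrN (ger0_norm (ltW e0)).
    apply: lerD; first by rewrite -[leRHS]mulr1 ler_wpM2l ?(ltW e0)//
      ler_norml cos_geN1 cos_le1.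
    by rewrite -[leRHS]mulr1 ler_wpM2l// ler_norml sin_geN1 sin_le1.
  have cM : M * expR (- (e * x)) @[x --> +oo] --> 0.
    rewrite -[X in _ --> X](mulr0 M); apply: cvgM; first exact: cvg_cst.
    apply: (cvg_comp (fun x => e * x) (fun y => expR (- y)) _ (@cvgr_expR R)).
    exact: gt0_cvgMry.
  apply: (squeeze_cvgr (f := fun x => - (M * expR (- (e * x)))) _ _ cM).
    by apply: nearW => x; rewrite -ler_norml.
  by rewrite -oppr0; exact: cvgN.
- by move=> x _; exact: ex_derive.
- apply: cvg_at_right_filter; apply: differentiable_continuous;
    apply/derivable1_diffP.
  exact: ex_derive.
- by move=> x _; rewrite derive1E; exact: derive_val.
Qed.

Lemma integral_exp_cos (e z b : R) : 0 < e ->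
  (\int[leb]_x (expR (- (e * `|x|)) * (1 + cos (x * z + b)))%:E =
   (2 / e + cos b * (2 * e / (e ^+ 2 + z ^+ 2)))%:E)%E.
Proof.
move=> e0; have ez : e ^+ 2 + z ^+ 2 != 0.
  by rewrite gt_eqF// ltr_pwDl ?exprn_gt0 ?sqr_ge0.
rewrite (@ge0_integral_fold (fun x =>
  expR (- (e * `|x|)) * (1 + cos (x * z + b)))).
- under eq_integral => x.
    rewrite inE /= in_itv /= andbT => x0; rewrite ger0_norm//; over.
  rewrite halfline_exp_cos//.
  under eq_integral => x.
    rewrite inE /= in_itv /= andbT => x0;
      rewrite normrN ger0_norm// mulNr -mulrN; over.
  rewrite halfline_exp_cos// -EFinD; congr EFin; field.
by rewrite ez gt_eqF.
- by move=> x; rewrite mulr_ge0 ?expR_ge0//; have := cos_geN1 (x * z + b); lra.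
move=> x; apply: cvgM.
  apply: continuous_comp; last exact: continuous_expR.
  apply: cvgN; apply: cvgM; first exact: cvg_cst.
  exact: norm_continuous.
apply: cvgD; first exact: cvg_cst.
apply: continuous_comp; last exact: continuous_cos.
by apply: cvgD; [apply: cvgM => //; exact: cvg_cst|exact: cvg_cst].
Qed.

Lemma integral_exp_abs (e : R) : 0 < e ->
  (\int[leb]_x (expR (- (e * `|x|)))%:E = (2 / e)%:E)%E.
Proof.
move=> e0; have := integral_exp_cos 0 0 e0.
under eq_integral => x _.
  rewrite mulr0 addr0 cos0 mulrC EFinM; over.
rewrite ge0_integralZl//.
- rewrite cos0 mul1r expr0n/= addr0 => h.
  have e2 : e != 0 by rewrite gt_eqF.
  have {h} : (2%:E * \int[leb]_x (expR (- (e * `|x|)))%:E = 2%:E * (2 /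
    e)%:E)%E.
    by rewrite h -EFinM; congr EFin; field.
  by move/(congr1 (mule (2^-1)%:E));
    rewrite !muleA -!EFinM mulVf ?pnatr_eq0// mul1e mul1r.
- apply/measurable_EFinP; apply: continuous_measurable_fun => x.
  apply: continuous_comp; last exact: continuous_expR.
  by apply: cvgN; apply: cvgM; [exact: cvg_cst|exact: norm_continuous].
Qed.

Lemma halfline_poisson (e z : R) : 0 < e ->
  (\int[leb]_(x in `[0%R, +oo[) (2 * e / (e ^+ 2 + (z - x) ^+ 2))%:E =
   (pi - 2 * atan (- z / e))%:E)%E.
Proof.
move=> e0; have en0 : e != 0 by rewrite gt_eqF.
have ez x : e ^+ 2 + (z - x) ^+ 2 != 0.
  by rewrite gt_eqF// ltr_pwDl ?exprn_gt0 ?sqr_ge0.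
pose F (x : R) := 2 * atan ((x - z) / e).
have dF (x : R) : is_derive x 1 F (2 * e / (e ^+ 2 + (z - x) ^+ 2)).
  rewrite /F; apply: is_derive_eq.
  rewrite /GRing.scale /= ?mulr0 ?addr0 ?mulr1 ?add0r.
  have := ez x; move: (x - z) (opprB x z) => y <-; rewrite sqrrN => ezy.
  field; rewrite en0 /= ?ezy //.
have cf : continuous (fun x => 2 * e / (e ^+ 2 + (z - x) ^+ 2)).
  move=> x; apply: differentiable_continuous; apply/derivable1_diffP.
  exact: ex_derive.
rewrite (ge0_continuous_FTC2y (F := F) (l := pi)).
- by rewrite /F sub0r.
- by move=> x _; rewrite divr_ge0 ?mulr_ge0 ?(ltW e0)// addr_ge0 ?sqr_ge0.
- exact: continuous_subspaceT.
- rewrite (_ : pi = 2 * (pi / 2)); last by field.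
  apply: cvgM; first exact: cvg_cst.
  apply: (cvg_comp (fun x => (x - z) / e) (@atan R) _ (@cvgy_atan R)).
  apply: gt0_cvgMly; first by rewrite invr_gt0.
  exact: cvg_addrr.
- by move=> x _; exact: ex_derive.
- apply: cvg_at_right_filter; apply: differentiable_continuous;
    apply/derivable1_diffP.
  exact: ex_derive.
- by move=> x _; rewrite derive1E; exact: derive_val.
Qed.

Lemma integral_poisson (e z : R) : 0 < e ->
  (\int[leb]_x (2 * e / (e ^+ 2 + (z - x) ^+ 2))%:E = (2 * pi)%:E)%E.
Proof.
move=> e0; have en0 : e != 0 by rewrite gt_eqF.
have ez x : e ^+ 2 + (z - x) ^+ 2 != 0.
  by rewrite gt_eqF// ltr_pwDl ?exprn_gt0 ?sqr_ge0.
rewrite (@ge0_integral_fold (fun x => 2 * e / (e ^+ 2 + (z - x) ^+ 2))).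
- rewrite halfline_poisson//.
  under eq_integral => x _.
    rewrite (_ : (z - - x) ^+ 2 = (- z - x) ^+ 2); last by ring.
    over.
  rewrite halfline_poisson// -EFinD; congr EFin.
  by rewrite opprK mulNr atanN; ring.
- by move=> x; rewrite divr_ge0 ?mulr_ge0 ?(ltW e0)// addr_ge0 ?sqr_ge0.
- move=> x; apply: differentiable_continuous; apply/derivable1_diffP.
  exact: ex_derive.
Qed.

End ExponentialWeight.

(** * The exponential weight and its Fourier transform *)

Section ProductKernels.
Context {R : realType}.
Local Notation leb := (@lebesgue_measure R).
Implicit Types n : nat.

(** The weight is a product, so that its Fourier transform is computed one
    coordinate at a time. *)
Definition exp_weight n (e : R) (x : 'rV[R]_n) : R :=
  \prod_i expR (- (e * `|x ord0 i|)).

(** This is the Fourier transform of [exp_weight e]: a product of Poisson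
    kernels. *)
Definition poisson n (e : R) (z : 'rV[R]_n) : R :=
  \prod_i (2 * e / (e ^+ 2 + z ord0 i ^+ 2)).

Lemma exp_weight_ge0 n e (x : 'rV[R]_n) : 0 <= exp_weight e x.
Proof. by apply: prodr_ge0 => i _; exact: expR_ge0. Qed.

Lemma poisson_ge0 n e (z : 'rV[R]_n) : 0 <= e -> 0 <= poisson e z.
Proof.
move=> e0; apply: prodr_ge0 => i _.
by rewrite divr_ge0 ?mulr_ge0// addr_ge0 ?sqr_ge0.
Qed.

Lemma poisson_le n e (z : 'rV[R]_n) : 0 < e -> poisson e z <= (2 / e) ^+ n.
Proof.
move=> e0; rewrite -[in leRHS](card_ord n) -prodr_const; apply: ler_prod => i _.
rewrite divr_ge0 ?mulr_ge0 ?(ltW e0)//= ?addr_ge0 ?sqr_ge0//.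
rewrite ler_pdivrMr; last by rewrite ltr_pwDl ?exprn_gt0 ?sqr_ge0.
have -> : 2 * e = 2 / e * e ^+ 2 by field; rewrite gt_eqF.
by rewrite ler_wpM2l ?divr_ge0 ?(ltW e0)// lerDl sqr_ge0.
Qed.

Lemma exp_weight_cons n e s (v : 'rV[R]_n) :
  exp_weight e (cons_rV (s, v)) = expR (- (e * `|s|)) * exp_weight e v.
Proof.
rewrite /exp_weight big_ord_recl cons_rV0; congr (_ * _).
by apply: eq_bigr => i _; rewrite cons_rVS.
Qed.

Lemma measurable_exp_weight n e : measurable_fun setT (@exp_weight n e).
Proof.
apply: measurable_prod => i _.
apply: (measurableT_comp (f := fun y : R => expR (- (e * `|y|))));
  last exact: measurable_rV_entry.
apply: continuous_measurable_fun => x; apply: continuous_comp;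
  last exact: continuous_expR.
by apply: cvgN; apply: cvgM; [exact: cvg_cst|exact: norm_continuous].
Qed.

Lemma measurable_poisson_sub d (T : measurableType d) n e
  (f g : T -> 'rV[R]_n) :
  0 < e -> measurable_fun setT f -> measurable_fun setT g ->
  measurable_fun setT (fun x => poisson e (f x - g x)).
Proof.
move=> e0 mf mg; apply: measurable_prod => i _.
under eq_fun do rewrite !mxE.
apply: (measurableT_comp (f := fun y : R => 2 * e / (e ^+ 2 + y ^+ 2))).
  have ez x : e ^+ 2 + x ^+ 2 != 0.
    by rewrite gt_eqF// ltr_pwDl ?exprn_gt0 ?sqr_ge0.
  apply: continuous_measurable_fun => x.
  apply: differentiable_continuous; apply/derivable1_diffP; exact: ex_derive.
apply: measurable_funB.
- exact: measurableT_comp (@measurable_rV_entry R n i) mf.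
- exact: measurableT_comp (@measurable_rV_entry R n i) mg.
Qed.

Lemma measurable_cosD (b : R) : measurable_fun setT (fun y : R => cos (y + b)).
Proof.
apply: continuous_measurable_fun => x; apply: continuous_comp;
  last exact: continuous_cos.
by apply: cvgD; [exact: cvg_id|exact: cvg_cst].
Qed.

Lemma cosD1_ge0 (y : R) : 0 <= 1 + cos y.
Proof. by have := cos_geN1 y; lra. Qed.

(** The phase b is what makes the induction work: when the first coordinate is
    split off, its contribution to the scalar product becomes part of the
    phase of the other ones. The summand 1 keeps the integrand nonnegative, so
    that Tonelli is enough. *)
Lemma integral_exp_weight_cos n e (z : 'rV[R]_n) (b : R) : 0 < e ->
  (\int[lebesgue_rV n]_x (exp_weight e x * (1 + cos (dotv x z + b)))%:E =
   ((2 / e) ^+ n + cos b * poisson e z)%:E)%E.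
Proof.
move=> e0; have en0 : e != 0 by rewrite gt_eqF.
have m n' (z' : 'rV[R]_n') b' :
    measurable_fun setT (fun x : 'rV_n' =>
      (exp_weight e x * (1 + cos (dotv x z' + b')))%:E).
  apply/measurable_EFinP; apply: measurable_funM;
    first exact: measurable_exp_weight.
  apply: measurable_funD => //.
  apply: (measurableT_comp (measurable_cosD _)).
  exact: measurable_dotv.
have p n' (z' : 'rV[R]_n') b' x :
  0 <= exp_weight e x * (1 + cos (dotv x z' + b')).
  by rewrite mulr_ge0 ?exp_weight_ge0 ?cosD1_ge0.
elim: n z b => [|n IH] z b.
  rewrite [LHS]integral_dirac//= ?diracT ?mul1e; last exact: m.
  by rewrite /exp_weight /poisson /dotv !big_ord0 mul1r add0r mulr1 expr0.
rewrite ge0_integral_rV_succ//.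
pose z' := \row_j z ord0 (lift ord0 j).
pose A := (2 / e) ^+ n; pose P := poisson e z'.
under eq_integral => s _.
  under eq_integral => v _.
    rewrite exp_weight_cons dotv_cons -mulrA.
    rewrite (addrC (s * _)) -addrA EFinM; over.
  rewrite ge0_integralZl//= ?lee_fin ?expR_ge0//; last first.
  - by move=> x _; rewrite lee_fin p.
  - exact: m.
  rewrite IH -EFinM.
  (* both coefficients are nonnegative since 0 <= P <= A *)
  rewrite (_ : expR _ * (_ + _) = (A - P) * expR (- (e * `|s|)) +
      P * (expR (- (e * `|s|)) * (1 + cos (s * z ord0 ord0 + b)))); last first.
    by rewrite /A /P /z'; ring.
  rewrite EFinD EFinM [X in (_ + X)%E]EFinM; over.
have mE : measurable_fun setT (fun s : R => expR (- (e * `|s|))).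
  apply: continuous_measurable_fun => x; apply: continuous_comp;
    last exact: continuous_expR.
  by apply: cvgN; apply: cvgM; [exact: cvg_cst|exact: norm_continuous].
have mC : measurable_fun setT (fun s : R =>
  expR (- (e * `|s|)) * (1 + cos (s * z ord0 ord0 + b))).
  apply: measurable_funM => //; apply: measurable_funD => //.
  apply: (measurableT_comp (measurable_cosD _)).
  apply: (measurable_funM (f := fun s : R => s) (g := cst (z ord0 ord0))) => //.
have P0 : 0 <= P by rewrite poisson_ge0// ltW.
have AP : 0 <= A - P by rewrite subr_ge0 poisson_le.
rewrite ge0_integralD//=.
- rewrite ge0_integralZl//=; last exact/measurable_EFinP.
  rewrite ge0_integralZl//=; last exact/measurable_EFinP.
  rewrite integral_exp_abs// integral_exp_cos// -!EFinM -EFinD; congr EFin.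
  rewrite (exprS (2 / e)) /poisson big_ord_recl.
  rewrite (_ : \prod_(i < n) _ = P); last first.
    by apply: eq_bigr => i _; rewrite mxE.
  by rewrite -/A; ring.
- by move=> x _; rewrite -EFinM lee_fin mulr_ge0 ?expR_ge0.
- by apply/measurable_EFinP; apply: measurable_funM.
- by move=> x _; rewrite -EFinM lee_fin mulr_ge0// mulr_ge0 ?expR_ge0
    ?cosD1_ge0.
- by apply/measurable_EFinP; apply: measurable_funM.
by move=> x; rewrite lee_fin p.
Qed.

Lemma integral_exp_weight n e : 0 < e ->
  (\int[lebesgue_rV n]_x (exp_weight e x)%:E = ((2 / e) ^+ n)%:E)%E.
Proof.
move=> e0; have := @integral_exp_weight_cos n e 0 (pi / 2) e0.
rewrite cos_pihalf mul0r addr0 => <-; apply: eq_integral => x _.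
by rewrite /dotv big1 ?add0r ?cos_pihalf ?addr0 ?mulr1// => i _;
  rewrite mxE mulr0.
Qed.

(** The mass does not depend on e: this is what survives the limit e -> 0. *)
Lemma integral_poisson_sub n e (z : 'rV[R]_n) : 0 < e ->
  (\int[lebesgue_rV n]_x (poisson e (z - x))%:E = ((2 * pi) ^+ n)%:E)%E.
Proof.
move=> e0.
have m n' (z' : 'rV[R]_n') : measurable_fun setT (fun x : 'rV[R]_n' =>
  (poisson e (z' - x))%:E).
  by apply/measurable_EFinP; apply: measurable_poisson_sub.
elim: n z => [|n IH] z.
  rewrite [LHS]integral_dirac//= ?diracT ?mul1e; last exact: m.
  by rewrite /poisson big_ord0 expr0.
rewrite ge0_integral_rV_succ//; last by move=> x;
  rewrite lee_fin poisson_ge0// ltW.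
pose z' := \row_j z ord0 (lift ord0 j).
under eq_integral => s _.
  under eq_integral => v _.
    rewrite (_ : poisson _ _ = (2 * e / (e ^+ 2 + (z ord0 ord0 - s) ^+ 2)) *
      poisson e (z' - v)); last first.
      rewrite /poisson big_ord_recl !mxE unlift_none; congr (_ * _).
      by apply: eq_bigr => i _; rewrite !mxE liftK.
    rewrite EFinM; over.
  rewrite ge0_integralZl//=; last 2 first.
  - by move=> x _; rewrite lee_fin poisson_ge0// ltW.
  - by rewrite lee_fin divr_ge0 ?mulr_ge0 ?(ltW e0)// addr_ge0 ?sqr_ge0.
  rewrite IH muleC; over.
  exact: m.
have mP : measurable_fun setT (fun s : R =>
  2 * e / (e ^+ 2 + (z ord0 ord0 - s) ^+ 2)).
  have ez x : e ^+ 2 + (z ord0 ord0 - x) ^+ 2 != 0.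
    by rewrite gt_eqF// ltr_pwDl ?exprn_gt0 ?sqr_ge0.
  apply: continuous_measurable_fun => x.
  apply: differentiable_continuous; apply/derivable1_diffP; exact: ex_derive.
rewrite ge0_integralZl//=.
- by rewrite integral_poisson// -EFinM exprSr.
- exact/measurable_EFinP.
- by move=> x _; rewrite lee_fin divr_ge0 ?mulr_ge0 ?(ltW e0)// addr_ge0
    ?sqr_ge0.
- by rewrite lee_fin exprn_ge0// mulr_ge0// pi_ge0.
Qed.

End ProductKernels.

(** * Integrals depending on a parameter *)

Section ParametricIntegrals.
Context d1 d2 (T1 : measurableType d1) (T2 : measurableType d2) (R : realType).

Lemma measurable_section (f : T1 * T2 -> R) x :
  measurable_fun setT f -> measurable_fun setT (fun y => f (x, y)).
Proof. by move=> mf; exact: measurableT_comp mf (pair1_measurable x). Qed.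

Lemma measurable_section2 (f : T1 * T2 -> R) y :
  measurable_fun setT f -> measurable_fun setT (fun x => f (x, y)).
Proof. by move=> mf; exact: measurableT_comp mf (pair2_measurable y). Qed.

(** Measurability comes from Tonelli applied to the positive and negative
    parts, and so requires no joint integrability. *)
Lemma measurable_Rintegral (m2 : {sigma_finite_measure set T2 -> \bar R})
    (f : T1 * T2 -> R) :
  measurable_fun setT f -> measurable_fun setT (fun x => \int[m2]_y f (x, y)).
Proof.
move=> mf; apply: (measurableT_comp (f := @fine R)) => //.
rewrite (_ : (fun x => _) = (fun x => \int[m2]_y ((EFin \o f)^\+ (x, y)) -
                             \int[m2]_y ((EFin \o f)^\- (x, y)))%E).
  have mEf : measurable_fun setT (EFin \o f) by exact/measurable_EFinP.
  apply: emeasurable_funB.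
  - apply: (measurable_fun_fubini_tonelli_F (EFin \o f)^\+%E) => //.
    exact: measurable_funepos.
  - apply: (measurable_fun_fubini_tonelli_F (EFin \o f)^\-%E) => //.
    exact: measurable_funeneg.
by apply/funext => x; rewrite integralE; congr (_ - _)%E;
  apply: eq_integral => y _; rewrite ?funeposE ?funenegE.
Qed.

Lemma le_integrable_real d (T : measurableType d) (mu :
  {measure set T -> \bar R})
    (f g : T -> R) : measurable_fun setT f -> (forall x, `|f x| <= `|g x|) ->
  mu.-integrable setT (EFin \o g) -> mu.-integrable setT (EFin \o f).
Proof.
move=> mf fg; apply: le_integrable => //; first exact/measurable_EFinP.
by move=> x _ /=; rewrite lee_fin.
Qed.

Variables (m1 : {sigma_finite_measure set T1 -> \bar R})
          (m2 : {sigma_finite_measure set T2 -> \bar R}).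
Variables (f : T1 * T2 -> R) (p : T1 -> R) (q : T2 -> R).
Hypothesis mf : measurable_fun setT f.
Hypothesis ip : m1.-integrable setT (EFin \o p).
Hypothesis iq : m2.-integrable setT (EFin \o q).
Hypothesis fpq : forall x y, `|f (x, y)| <= `|p x| * `|q y|.

(** Domination by a tensor product of integrable functions is the form in
    which the hypothesis of Fubini is met throughout. *)
Lemma integrable_tensor_dominated : (m1 \x m2)%E.-integrable setT (EFin \o f).
Proof.
apply/integrable12ltyP; first exact/measurable_EFinP.
have mp : measurable_fun setT p by apply/measurable_EFinP;
  exact: measurable_int ip.
have mq : measurable_fun setT q by apply/measurable_EFinP;
  exact: measurable_int iq.
apply: (@le_lt_trans _ _ (\int[m1]_x (`|p x|%:E * \int[m2]_y `|q y|%:E))%E).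
  apply: ge0_le_integral => //.
  - by move=> x _; apply: integral_ge0.
  - apply: (measurable_fun_fubini_tonelli_F (fun z => `|(EFin \o f) z|%E)) =>
      //.
    by apply: measurableT_comp => //; exact/measurable_EFinP.
  - apply: emeasurable_funM; last exact: measurable_cst.
    by apply/measurable_EFinP; exact: measurableT_comp.
  move=> x _; rewrite -ge0_integralZl//; last first.
    by apply/measurable_EFinP; exact: measurableT_comp.
  apply: ge0_le_integral => //.
  - apply/measurable_EFinP; apply: measurableT_comp => //;
      exact: measurable_section.
  - by apply/measurable_EFinP; apply: measurable_funM => //;
      exact: measurableT_comp.
  - by move=> y _ /=; rewrite lee_fin fpq.
rewrite ge0_integralZr//; last 2 first.
- by apply/measurable_EFinP; exact: measurableT_comp.
- by apply: integral_ge0.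
move/integrableP : ip => [_ /= ip']; move/integrableP : iq => [_ /= iq'].
by rewrite lte_mul_pinfty// ?integral_ge0// ge0_fin_numE// integral_ge0.
Qed.

Lemma integrable_section_dominated x : m2.-integrable setT (fun y =>
  (f (x, y))%:E).
Proof.
apply: (@le_integrable_real _ _ m2 (fun y => f (x, y)) (fun y => p x * q y)).
- exact: measurable_section.
- by move=> y; rewrite normrM.
- rewrite (_ : EFin \o _ = fun y => ((p x)%:E * (EFin \o q) y)%E) //.
  exact: integrableZl.
Qed.

Lemma integrable_section_dominated2 y : m1.-integrable setT (fun x =>
  (f (x, y))%:E).
Proof.
apply: (@le_integrable_real _ _ m1 (fun x => f (x, y)) (fun x => q y * p x)).
- exact: measurable_section2.
- by move=> x; rewrite normrM mulrC.
- rewrite (_ : EFin \o _ = fun x => ((q y)%:E * (EFin \o p) x)%E) //.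
  exact: integrableZl.
Qed.

Lemma Rintegral_swap :
  \int[m1]_x \int[m2]_y f (x, y) = \int[m2]_y \int[m1]_x f (x, y).
Proof.
rewrite /Rintegral; congr fine.
under eq_integral => x _.
  rewrite fineK; last exact/integrable_fin_num/integrable_section_dominated.
  over.
under [RHS]eq_integral => y _.
  rewrite fineK; last exact/integrable_fin_num/integrable_section_dominated2.
  over.
exact: (Fubini integrable_tensor_dominated).
Qed.

End ParametricIntegrals.

(** * The cosine and sine transforms in mean square *)

Section Bessel.
Context {R : realType} {n : nat}.
Local Notation mu := (@lebesgue_rV R n).
Local Notation rV := 'rV[R]_n.
Implicit Types h : rV -> R.

Definition cos_transform h (x : rV) : R := \int[mu]_xi (cos (dotv x xi) * h xi).
Definition sin_transform h (x : rV) : R := \int[mu]_xi (sin (dotv x xi) * h xi).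

Lemma dotvC (x y : rV) : dotv x y = dotv y x.
Proof. by apply: eq_bigr => i _; rewrite mulrC. Qed.

Lemma dotvBr (x y z : rV) : dotv x (y - z) = dotv x y - dotv x z.
Proof. by rewrite /dotv -sumrB; apply: eq_bigr => i _; rewrite !mxE mulrBr. Qed.

Lemma measurable_cos_dotv d (T : measurableType d) (f g : T -> rV) :
  measurable_fun setT f -> measurable_fun setT g ->
  measurable_fun setT (fun x => cos (dotv (f x) (g x))).
Proof.
move=> mf mg; apply: (measurableT_comp (f := @cos R)).
  by apply: continuous_measurable_fun; exact: continuous_cos.
exact: measurable_dotv.
Qed.

Lemma measurable_sin_dotv d (T : measurableType d) (f g : T -> rV) :
  measurable_fun setT f -> measurable_fun setT g ->
  measurable_fun setT (fun x => sin (dotv (f x) (g x))).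
Proof.
move=> mf mg; apply: (measurableT_comp (f := @sin R)).
  by apply: continuous_measurable_fun; exact: continuous_sin.
exact: measurable_dotv.
Qed.

Lemma integrable_measurable d (T : measurableType d)
    (m : {measure set T -> \bar R}) (h : T -> R) :
  m.-integrable setT (EFin \o h) -> measurable_fun setT h.
Proof. by move=> ih; apply/measurable_EFinP; exact: measurable_int ih. Qed.

Lemma integrable_scale d (T : measurableType d)
    (m : {measure set T -> \bar R}) (h : T -> R) (c : R) :
  m.-integrable setT (EFin \o h) ->
    m.-integrable setT (EFin \o (fun x => c * h x)).
Proof.
move=> ih; rewrite (_ : EFin \o _ = fun x => (c%:E * (EFin \o h) x)%E) //.
exact: integrableZl.
Qed.

Lemma integrable_bounded_mul d (T : measurableType d)
    (m : {measure set T -> \bar R}) (k h : T -> R) (M : R) :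
  measurable_fun setT k -> (forall x, `|k x| <= M) ->
  m.-integrable setT (EFin \o h) ->
    m.-integrable setT (EFin \o (fun x => k x * h x)).
Proof.
move=> mk kM ih; apply: (@le_integrable_real R _ _ m _ (fun x => M * h x)).
- by apply: measurable_funM => //; exact: integrable_measurable ih.
- move=> x; rewrite !normrM ler_wpM2r//; exact: le_trans (kM x) (ler_norm _).
- exact: integrable_scale.
Qed.

Lemma Rintegral_bounded_mul_le d (T : measurableType d)
    (m : {measure set T -> \bar R}) (k h : T -> R) (M : R) :
  measurable_fun setT k -> (forall x, `|k x| <= M) ->
  m.-integrable setT (EFin \o h) ->
  `|\int[m]_x (k x * h x)| <= M * \int[m]_x `|h x|.
Proof.
move=> mk kM ih.
have ia : m.-integrable setT (EFin \o (fun x => `|h x|)).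
  exact: (integrable_abse ih).
apply: (le_trans (le_normr_Rintegral _ _)) => //.
  exact: integrable_bounded_mul mk kM ih.
rewrite -RintegralZl//; apply: le_Rintegral => //.
- exact: (integrable_abse (integrable_bounded_mul mk kM ih)).
- exact: integrable_scale.
- by move=> x _; rewrite normrM ler_wpM2r.
Qed.

Section FixedFunction.
Variable h : rV -> R.
Hypothesis ih : mu.-integrable setT (EFin \o h).
Let mh : measurable_fun setT h := integrable_measurable ih.
Let H : R := \int[mu]_xi `|h xi|.

Lemma integrable_cos_mul x : mu.-integrable setT (EFin \o (fun xi =>
  cos (dotv x xi) * h xi)).
Proof.
apply: (@integrable_bounded_mul _ _ _ _ _ 1) => //;
  first exact: measurable_cos_dotv.
by move=> y; exact: cos_max.
Qed.

Lemma integrable_sin_mul x : mu.-integrable setT (EFin \o (fun xi =>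
  sin (dotv x xi) * h xi)).
Proof.
apply: (@integrable_bounded_mul _ _ _ _ _ 1) => //;
  first exact: measurable_sin_dotv.
by move=> y; exact: sin_max.
Qed.

Lemma cos_transform_le x : `|cos_transform h x| <= H.
Proof.
rewrite -[leRHS]mul1r; apply: Rintegral_bounded_mul_le => //.
  exact: measurable_cos_dotv.
by move=> y; exact: cos_max.
Qed.

Lemma sin_transform_le x : `|sin_transform h x| <= H.
Proof.
rewrite -[leRHS]mul1r; apply: Rintegral_bounded_mul_le => //.
  exact: measurable_sin_dotv.
by move=> y; exact: sin_max.
Qed.

Lemma measurable_cos_transform : measurable_fun setT (cos_transform h).
Proof.
apply: (measurable_Rintegral mu (f := fun z : rV * rV =>
  cos (dotv z.1 z.2) * h z.2)).
apply: measurable_funM; first exact: measurable_cos_dotv.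
exact: measurableT_comp.
Qed.

Lemma measurable_sin_transform : measurable_fun setT (sin_transform h).
Proof.
apply: (measurable_Rintegral mu (f := fun z : rV * rV =>
  sin (dotv z.1 z.2) * h z.2)).
apply: measurable_funM; first exact: measurable_sin_dotv.
exact: measurableT_comp.
Qed.

(** The addition formula for the cosine turns the two products into a single
    transform, whose kernel depends on xi - eta only. *)
Lemma cos_transform_sub x xi :
  cos (dotv x xi) * cos_transform h x + sin (dotv x xi) * sin_transform h x =
  \int[mu]_eta (cos (dotv x (xi - eta)) * h eta).
Proof.
rewrite -RintegralZl//; last exact: integrable_cos_mul.
rewrite -RintegralZl//; last exact: integrable_sin_mul.
rewrite -RintegralD//.
- by apply: eq_Rintegral => eta _; rewrite dotvBr cosB; ring.
- by apply: integrable_scale; exact: integrable_cos_mul.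
- by apply: integrable_scale; exact: integrable_sin_mul.
Qed.

(** One of the two factors of each square is written as an integral; the other
    one is kept, so that the next step is an interchange of two integrals
    instead of three. *)
Lemma sqr_transforms x : cos_transform h x ^+ 2 + sin_transform h x ^+ 2 =
  \int[mu]_xi ((cos (dotv x xi) * cos_transform h x +
                sin (dotv x xi) * sin_transform h x) * h xi).
Proof.
set C := cos_transform h x; set S := sin_transform h x.
transitivity (\int[mu]_xi (C * (cos (dotv x xi) * h xi) + S * (sin (dotv x
  xi) * h xi))).
  rewrite RintegralD//.
  - by rewrite !RintegralZl//;
      [exact: integrable_sin_mul|exact: integrable_cos_mul].
  - by apply: integrable_scale; exact: integrable_cos_mul.
  - by apply: integrable_scale; exact: integrable_sin_mul.
by apply: eq_Rintegral => xi _; ring.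
Qed.

Variable e : R.
Hypothesis e0 : 0 < e.

Lemma integrable_exp_weight : mu.-integrable setT (EFin \o @exp_weight R n e).
Proof.
apply/integrableP; split; first by apply/measurable_EFinP;
  exact: measurable_exp_weight.
under eq_integral => x _ do rewrite /= ger0_norm ?exp_weight_ge0//.
by rewrite integral_exp_weight// ltry.
Qed.

Lemma integrable_exp_weight_cos (z : rV) :
  mu.-integrable setT (EFin \o (fun x => exp_weight e x * cos (dotv x z))).
Proof.
rewrite (_ : EFin \o _ = EFin \o (fun x => cos (dotv x z) * exp_weight e x)).
  apply: (@integrable_bounded_mul _ _ _ _ _ 1);
    last exact: integrable_exp_weight.
    exact: measurable_cos_dotv.
  by move=> y; exact: cos_max.
by apply/funext => x /=; rewrite mulrC.
Qed.

Lemma Rintegral_exp_weight_cos (z : rV) :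
  \int[mu]_x (exp_weight e x * cos (dotv x z)) = poisson e z.
Proof.
have i1 := integrable_exp_weight.
have i2 := integrable_exp_weight_cos z.
have := integral_exp_weight_cos z 0 e0; rewrite cos0 mul1r.
under eq_integral => x _ do rewrite addr0 mulrDr mulr1.
move/(congr1 fine) => /=.
rewrite -/(Rintegral mu setT (fun x =>
  exp_weight e x + exp_weight e x * cos (dotv x z))).
rewrite RintegralD//.
have -> : \int[mu]_x exp_weight e x = (2 / e) ^+ n.
  by rewrite /Rintegral integral_exp_weight.
by move=> /addrI.
Qed.

(** Two interchanges of integrals, first of x with xi and then of x with eta,
    isolate the integral in x, which is the Fourier transform of the weight at
    xi - eta. *)
Lemma weighted_sqr_transforms :
  \int[mu]_x (exp_weight e x * (cos_transform h x ^+ 2 + sin_transform h x ^+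
    2)) =
  \int[mu]_xi \int[mu]_eta (poisson e (xi - eta) * (h xi * h eta)).
Proof.
pose F (z : rV * rV) := exp_weight e z.1 *
  ((cos (dotv z.1 z.2) * cos_transform h z.1 + sin (dotv z.1 z.2) *
    sin_transform h z.1) * h z.2).
have mF : measurable_fun setT F.
  apply: measurable_funM; first exact: (measurableT_comp
    (@measurable_exp_weight R n e)).
  apply: measurable_funM; last exact: measurableT_comp.
  apply: measurable_funD; apply: measurable_funM.
  - exact: measurable_cos_dotv.
  - exact: (measurableT_comp measurable_cos_transform).
  - exact: measurable_sin_dotv.
  - exact: (measurableT_comp measurable_sin_transform).
have H0 : 0 <= H by apply: Rintegral_ge0.
transitivity (\int[mu]_x \int[mu]_xi F (x, xi)).
  apply: eq_Rintegral => x _; rewrite sqr_transforms -RintegralZl//.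
  apply: (@integrable_bounded_mul _ _ _ _ _ (H + H)) => //.
    apply: measurable_funD; apply: measurable_funM => //.
    - exact: measurable_cos_dotv.
    - exact: measurable_sin_dotv.
  move=> xi; apply: (le_trans (ler_normD _ _)); rewrite !normrM.
  apply: lerD; rewrite -[leRHS]mul1r ler_pM//.
  - exact: cos_max.
  - exact: cos_transform_le.
  - exact: sin_max.
  - exact: sin_transform_le.
rewrite (@Rintegral_swap _ _ _ _ R mu mu F (fun x =>
  (H + H) * exp_weight e x) h)//; last 2 first.
- by apply: integrable_scale; exact: integrable_exp_weight.
- move=> x xi; rewrite /F /= mulrA normrM ler_wpM2r// [leRHS]normrM mulrC
    normrM ler_wpM2r//.
  rewrite (ger0_norm (addr_ge0 H0 H0)).
  apply: (le_trans (ler_normD _ _)); rewrite !normrM.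
  apply: lerD; rewrite -[leRHS]mul1r ler_pM//.
  - exact: cos_max.
  - exact: cos_transform_le.
  - exact: sin_max.
  - exact: sin_transform_le.
apply: eq_Rintegral => xi _.
pose G (z : rV * rV) := exp_weight e z.1 * (cos (dotv z.1 (xi - z.2)) * h z.2).
have mG : measurable_fun setT G.
  apply: measurable_funM; first exact: (measurableT_comp
    (@measurable_exp_weight R n e)).
  apply: measurable_funM; last exact: measurableT_comp.
  under eq_fun do rewrite dotvBr.
  apply: (measurableT_comp (f := @cos R)).
    by apply: continuous_measurable_fun; exact: continuous_cos.
  by apply: measurable_funB; exact: measurable_dotv.
have icos (x : rV) : mu.-integrable setT
    (EFin \o (fun eta => cos (dotv x (xi - eta)) * h eta)).
  apply: (@integrable_bounded_mul _ _ _ _ _ 1) => //; last by move=> z;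
    exact: cos_max.
  under eq_fun do rewrite dotvBr.
  apply: (measurableT_comp (f := @cos R)).
    by apply: continuous_measurable_fun; exact: continuous_cos.
  by apply: measurable_funB => //; exact: measurable_dotv.
transitivity (\int[mu]_x ((\int[mu]_eta G (x, eta)) * h xi)).
  apply: eq_Rintegral => x _; rewrite /F /= cos_transform_sub mulrA;
    congr (_ * _).
  by rewrite /G /= RintegralZl//; exact: icos.
rewrite RintegralZr//; last first.
  apply: (@le_integrable_real R _ _ mu _ (fun x => H * exp_weight e x)).
  - exact: (measurable_Rintegral mu mG).
  - move=> x; rewrite normrM (ger0_norm H0) mulrC (ger0_norm (exp_weight_ge0
      e x)).
    rewrite /G /= RintegralZl//.
    rewrite normrM (ger0_norm (exp_weight_ge0 e x)) ler_wpM2l ?exp_weight_ge0//.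
    rewrite -[leRHS]mul1r; apply: Rintegral_bounded_mul_le => //.
      under eq_fun do rewrite dotvBr.
      apply: (measurableT_comp (f := @cos R)).
        by apply: continuous_measurable_fun; exact: continuous_cos.
      by apply: measurable_funB => //; exact: measurable_dotv.
    by move=> y; exact: cos_max.
  - by apply: integrable_scale; exact: integrable_exp_weight.
rewrite (@Rintegral_swap _ _ _ _ R mu mu G (@exp_weight R n e) h)//;
  last 2 first.
- exact: integrable_exp_weight.
- move=> x eta; rewrite /G /= !normrM ler_wpM2l// -[leRHS]mul1r ler_wpM2r//.
  exact: cos_max.
have mP : measurable_fun setT (fun eta : rV => poisson e (xi - eta)).
  exact: measurable_poisson_sub.
have PM eta : `|poisson e (xi - eta)| <= (2 / e) ^+ n.
  by rewrite ger0_norm ?poisson_ge0 ?(ltW e0)// poisson_le.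
transitivity ((\int[mu]_eta (poisson e (xi - eta) * h eta)) * h xi).
  congr (_ * _); apply: eq_Rintegral => eta _.
  rewrite -Rintegral_exp_weight_cos -RintegralZr//;
    last exact: integrable_exp_weight_cos.
  by apply: eq_Rintegral => x _; rewrite /G /= mulrA.
rewrite -RintegralZr//; last exact: integrable_bounded_mul mP PM ih.
by apply: eq_Rintegral => eta _; rewrite -mulrA (mulrC (h eta)).
Qed.

End FixedFunction.

End Bessel.

Section BesselInequality.
Context {R : realType} {n : nat}.
Local Notation mu := (@lebesgue_rV R n).
Local Notation rV := 'rV[R]_n.

Lemma abse_fine_le (x : \bar R) : (`|(fine x)%:E| <= `|x|)%E.
Proof. by case: x => [r| |] //=; rewrite ?normr0 ?leey. Qed.

(** In this form the weight is visibly monotone in e and tends to 1 as e tends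
    to 0. *)
Lemma exp_weightE e (x : rV) :
  exp_weight e x = expR (- (e * \sum_i `|x ord0 i|)).
Proof.
rewrite /exp_weight mulr_sumr -sumrN.
by rewrite (big_morph expR (@expRD R) (@expR0 R)).
Qed.

Variable h : rV -> R.
Hypothesis ih : mu.-integrable setT (EFin \o h).

(** Schur's test: 2 |h(xi) h(eta)| <= h(xi)^2 + h(eta)^2, and the kernel is
    symmetric with the same mass in each of its variables. *)
Lemma schur_poisson e : 0 < e ->
  (`|\int[mu]_xi \int[mu]_eta (poisson e (xi - eta) * (h xi * h eta))|%:E <=
   ((2 * pi) ^+ n)%:E * \int[mu]_xi (h xi ^+ 2)%:E)%E.
Proof.
move=> e0; have mh := integrable_measurable ih.
pose K (z : rV * rV) := poisson e (z.1 - z.2).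
have K0 z : 0 <= K z by rewrite poisson_ge0// ltW.
have mK : measurable_fun setT K by exact: measurable_poisson_sub.
have mh1 : measurable_fun setT (fun z : rV * rV =>
  h z.1) by exact: measurableT_comp.
have mh2 : measurable_fun setT (fun z : rV * rV =>
  h z.2) by exact: measurableT_comp.
pose f1 (z : rV * rV) := (K z * (h z.1 ^+ 2 / 2))%:E.
pose f2 (z : rV * rV) := (K z * (h z.2 ^+ 2 / 2))%:E.
have mf1 : measurable_fun setT f1.
  by apply/measurable_EFinP; apply: measurable_funM => //;
    apply: measurable_funM => //; exact: measurable_funX.
have mf2 : measurable_fun setT f2.
  by apply/measurable_EFinP; apply: measurable_funM => //;
    apply: measurable_funM => //; exact: measurable_funX.
have f10 z : (0 <= f1 z)%E by rewrite lee_fin mulr_ge0// divr_ge0// sqr_ge0.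
have f20 z : (0 <= f2 z)%E by rewrite lee_fin mulr_ge0// divr_ge0// sqr_ge0.
have mhh : measurable_fun setT (fun z : rV * rV => K z * (h z.1 * h z.2)).
  by apply: measurable_funM => //; exact: measurable_funM.
have mh22 : measurable_fun setT (fun x : rV => h x ^+ 2 / 2).
  by apply: measurable_funM => //; exact: measurable_funX.
pose I := (\int[mu]_xi (h xi ^+ 2 / 2)%:E)%E.
have II : (\int[mu]_xi (h xi ^+ 2)%:E = I + I)%E.
  rewrite /I -ge0_integralD//=; last 4 first.
  - by move=> x _; rewrite lee_fin divr_ge0// sqr_ge0.
  - exact/measurable_EFinP.
  - by move=> x _; rewrite lee_fin divr_ge0// sqr_ge0.
  - exact/measurable_EFinP.
  by apply: eq_integral => x _; rewrite -EFinD; congr EFin; field.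
have inner (x : rV) (c : R) : 0 <= c -> (\int[mu]_y (poisson e (x - y) * c)%:E =
    ((2 * pi) ^+ n)%:E * c%:E)%E.
  move=> c0; under eq_integral => y _ do rewrite mulrC EFinM.
  rewrite ge0_integralZl//=.
  - by rewrite integral_poisson_sub// muleC.
  - by apply/measurable_EFinP; exact: measurable_poisson_sub.
  - by move=> y _; rewrite lee_fin poisson_ge0// ltW.
have I1 : (\int[mu]_x fubini_F mu f1 x = ((2 * pi) ^+ n)%:E * I)%E.
  rewrite /I -ge0_integralZl//=.
  - by apply: eq_integral => x _;
      rewrite /fubini_F /f1/= inner// divr_ge0// sqr_ge0.
  - exact/measurable_EFinP.
  - by move=> x _; rewrite lee_fin divr_ge0// sqr_ge0.
  - by rewrite lee_fin exprn_ge0// mulr_ge0// pi_ge0.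
have I2 : (\int[mu]_x fubini_F mu f2 x = ((2 * pi) ^+ n)%:E * I)%E.
  rewrite -I1 -(@fubini_tonelli1 _ _ _ _ R mu mu f2 mf2 f20).
  rewrite (@fubini_tonelli2 _ _ _ _ R mu mu f2 mf2 f20).
  apply: eq_integral => x _; rewrite /fubini_F /fubini_G /f1 /f2.
  apply: eq_integral => y _; rewrite /K /=; congr (_ * _)%:E.
  by apply: eq_bigr => i _; rewrite !mxE; congr (_ / (_ + _));
    rewrite -[LHS]sqrrN opprB.
rewrite II muleDr//; last by rewrite ge0_adde_def// inE integral_ge0// =>
  x _; rewrite lee_fin divr_ge0// sqr_ge0.
rewrite -[X in (_ <= X + _)%E]I1 -[X in (_ <= _ + X)%E]I2 -ge0_integralD//=;
  last 4 first.
- by move=> x _; apply: integral_ge0.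
- exact: measurable_fun_fubini_tonelli_F.
- by move=> x _; apply: integral_ge0.
- exact: measurable_fun_fubini_tonelli_F.
apply: (le_trans (abse_fine_le _)).
apply: (le_trans (le_abse_integral _ _ _)) => //.
  apply/measurable_EFinP.
  exact: (measurable_Rintegral mu mhh).
apply: ge0_le_integral => //.
- apply: measurableT_comp => //; apply/measurable_EFinP.
  exact: (measurable_Rintegral mu mhh).
- by apply: emeasurable_funD; exact: measurable_fun_fubini_tonelli_F.
move=> xi _; apply: (le_trans (abse_fine_le _)).
have mx : measurable_fun setT (fun y => K (xi, y) * (h xi * h y)).
  exact: measurable_section mhh.
apply: (le_trans (le_abse_integral _ _ _)) => //; first exact/measurable_EFinP.
rewrite /fubini_F -ge0_integralD//=; last 2 first.
- apply: (measurableT_comp mf1); exact: pair1_measurable.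
- apply: (measurableT_comp mf2); exact: pair1_measurable.
apply: ge0_le_integral => //.
- by apply/measurable_EFinP; exact: measurableT_comp.
- apply: emeasurable_funD.
  + apply: (measurableT_comp mf1); exact: pair1_measurable.
  + apply: (measurableT_comp mf2); exact: pair1_measurable.
move=> y _; rewrite /f1 /f2 /K /= -EFinD lee_fin -mulrDr normrM ger0_norm
  ?poisson_ge0 ?(ltW e0)//.
rewrite ler_wpM2l ?poisson_ge0 ?(ltW e0)// normrM -(normr_id (h xi))
  -(real_normK (num_real (h xi))) -(real_normK (num_real (h y))).
by have := sqr_ge0 (`|h xi| - `|h y|); rewrite normr_id; nra.
Qed.

(** Half of the Plancherel theorem. Only a bound is claimed, so that neither
    the inversion formula nor a density argument enters. *)
Theorem bessel_inequality :
  (\int[mu]_x (cos_transform h x ^+ 2 + sin_transform h x ^+ 2)%:E <=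
   ((2 * pi) ^+ n)%:E * \int[mu]_xi (h xi ^+ 2)%:E)%E.
Proof.
pose Q x := cos_transform h x ^+ 2 + sin_transform h x ^+ 2.
have Q0 x : 0 <= Q x by rewrite addr_ge0// sqr_ge0.
have mQ : measurable_fun setT Q.
  apply: measurable_funD; apply: measurable_funX.
  - exact: measurable_cos_transform.
  - exact: measurable_sin_transform.
pose g k x := (exp_weight k.+1%:R^-1 x * Q x)%:E.
have e0 k : 0 < k.+1%:R^-1 :> R by rewrite invr_gt0.
pose H : R := \int[mu]_xi `|h xi|.
(* boundedness makes the weighted integral finite, hence real-valued *)
have QH x : `|Q x| <= H ^+ 2 + H ^+ 2.
  rewrite ger0_norm// lerD// -(real_normK (num_real (_ x))) lerXn2r ?nnegrE
    ?Rintegral_ge0//.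
    exact: cos_transform_le.
  exact: sin_transform_le.
have mg k : measurable_fun setT (g k).
  by apply/measurable_EFinP; apply: measurable_funM => //;
    exact: measurable_exp_weight.
have g0 k x : (0 <= g k x)%E by rewrite lee_fin mulr_ge0// exp_weight_ge0.
have ndg x : {homo g ^~ x : k m / (k <= m)%N >-> (k <= m)%E}.
  move=> k m km; rewrite lee_fin ler_wpM2r//; apply: ler_prod => i _.
  rewrite expR_ge0/= ler_expR lerN2 ler_wpM2r//.
  by rewrite lef_pV2 ?posrE// ler_nat.
have cvgg x : g k x @[k --> \oo] --> (Q x)%:E.
  apply: cvg_EFin; first exact: nearW.
  rewrite (_ : _ \o _ = (fun k => exp_weight k.+1%:R^-1 x * Q x)) //.
  rewrite -[X in _ --> X]mul1r; apply: cvgM; last exact: cvg_cst.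
  under eq_fun do rewrite exp_weightE.
  have to0 : - (k.+1%:R^-1 * \sum_i `|x ord0 i|) @[k --> \oo] --> (0 : R).
    have := cvgN (cvgMr_tmp (b := \sum_i `|x ord0 i|) (cvg_harmonic (R := R))).
    by rewrite mul0r oppr0; apply; exact: eventually_filter.
  by have := cvg_comp _ _ to0 (@continuous_expR R 0); rewrite expR0.
have := cvg_monotone_convergence measurableT mg (fun k x _ =>
  g0 k x) (fun x _ => ndg x) => /(_ mu).
rewrite (_ : (fun x => _) = fun x => (Q x)%:E); last first.
  by apply/funext => x; apply/cvg_lim => //.
move=> cvgI; rewrite -/Q.
rewrite -(cvg_lim _ cvgI)//; apply: lime_le; first by apply/cvg_ex; eexists;
  exact: cvgI.
apply: nearW => k.
have igk : mu.-integrable setT (EFin \o (fun x =>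
  exp_weight k.+1%:R^-1 x * Q x)).
  rewrite (_ : EFin \o _ = EFin \o (fun x => Q x * exp_weight k.+1%:R^-1 x)).
    exact: (integrable_bounded_mul mQ QH (integrable_exp_weight (e0 k))).
  by apply/funext => x /=; rewrite mulrC.
rewrite -[leLHS]fineK; last exact: integrable_fin_num igk.
apply: le_trans (schur_poisson (e0 k)).
rewrite -weighted_sqr_transforms//.
by rewrite lee_fin; exact: ler_norm.
Qed.

End BesselInequality.

(** * The complex Fourier transform *)

Section ComplexFourier.
Context {R : realType} {n : nat}.
Local Notation mu := (@lebesgue_rV R n).
Local Notation rV := 'rV[R]_n.
Local Notation Re := complex.Re.
Local Notation Im := complex.Im.
Local Open Scope complex_scope.
Implicit Types f g phi : rV -> R[i].
Let c : R := ((2 * pi) ^+ n)^-1.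

Lemma ReM (z z' : R[i]) : Re (z * z') = Re z * Re z' - Im z * Im z'.
Proof. by case: z => ? ?; case: z' => ? ?. Qed.

Lemma ImM (z z' : R[i]) : Im (z * z') = Re z * Im z' + Im z * Re z'.
Proof. by case: z => ? ?; case: z' => ? ?. Qed.

Lemma ReB (z z' : R[i]) : Re (z - z') = Re z - Re z'.
Proof. by case: z => ? ?; case: z' => ? ?. Qed.

Lemma ImB (z z' : R[i]) : Im (z - z') = Im z - Im z'.
Proof. by case: z => ? ?; case: z' => ? ?. Qed.

(** The squared modulus as a real number, which avoids the square root in
    [Normc.normc]. *)
Definition sqn (z : R[i]) : R := Re z ^+ 2 + Im z ^+ 2.

Lemma sqn_ge0 (z : R[i]) : 0 <= sqn z.
Proof. by rewrite addr_ge0// sqr_ge0. Qed.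

Lemma sqnM (z z' : R[i]) : sqn (z * z') = sqn z * sqn z'.
Proof. by rewrite /sqn ReM ImM; ring. Qed.

Lemma normc_sqrt (z : R[i]) : Normc.normc z = Num.sqrt (sqn z).
Proof. by case: z. Qed.

Lemma Re_le_normc (z : R[i]) : `|Re z| <= Normc.normc z.
Proof. by rewrite normc_sqrt -sqrtr_sqr ler_wsqrtr// lerDl sqr_ge0. Qed.

Lemma Im_le_normc (z : R[i]) : `|Im z| <= Normc.normc z.
Proof. by rewrite normc_sqrt -sqrtr_sqr ler_wsqrtr// lerDr sqr_ge0. Qed.

Lemma normc_le (z : R[i]) : Normc.normc z <= `|Re z| + `|Im z|.
Proof.
rewrite normc_sqrt -[leRHS]ger0_norm ?addr_ge0// -sqrtr_sqr ler_wsqrtr//.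
rewrite /sqn -(real_normK (num_real (Re z))) -(real_normK (num_real (Im z))).
by have := normr_ge0 (Re z); have := normr_ge0 (Im z); nra.
Qed.

Lemma Rintegral_lin4 d (T : measurableType d) (m : {measure set T -> \bar R})
    (a1 a2 a3 a4 : T -> R) (c1 c2 c3 c4 : R) :
  m.-integrable setT (EFin \o a1) -> m.-integrable setT (EFin \o a2) ->
  m.-integrable setT (EFin \o a3) -> m.-integrable setT (EFin \o a4) ->
  \int[m]_x (c1 * a1 x + c2 * a2 x + (c3 * a3 x + c4 * a4 x)) =
  c1 * \int[m]_x a1 x + c2 * \int[m]_x a2 x +
  (c3 * \int[m]_x a3 x + c4 * \int[m]_x a4 x).
Proof.
move=> i1 i2 i3 i4.
have D (f g : T -> R) : m.-integrable setT (EFin \o f) ->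
    m.-integrable setT (EFin \o g) ->
      m.-integrable setT (EFin \o (fun x => f x + g x)).
  move=> If Ig; rewrite (_ : EFin \o _ = (EFin \o f) \+ (EFin \o g))%E //.
  exact: integrableD.
rewrite RintegralD//; try by apply: D; exact: integrable_scale.
by rewrite !RintegralD ?RintegralZl//; exact: integrable_scale.
Qed.

Lemma integrable_lin2 d (T : measurableType d) (m : {measure set T -> \bar R})
    (a1 a2 : T -> R) (c1 c2 : R) :
  m.-integrable setT (EFin \o a1) -> m.-integrable setT (EFin \o a2) ->
  m.-integrable setT (EFin \o (fun x => c1 * a1 x + c2 * a2 x)).
Proof.
move=> i1 i2; rewrite (_ : EFin \o _ =
  (EFin \o (fun x => c1 * a1 x)%R) \+ (EFin \o (fun x => c2 * a2 x)%R))%E //.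
by apply: integrableD => //; exact: integrable_scale.
Qed.

Lemma inv_fourierE g x : cintegrable g -> inv_fourier g x =
  (c * (cos_transform (fun y => Re (g y)) x - sin_transform (fun y =>
    Im (g y)) x)) +i*
  (c * (cos_transform (fun y => Im (g y)) x + sin_transform (fun y =>
    Re (g y)) x)).
Proof.
move=> [ig1 ig2]; rewrite /inv_fourier /cintegral -/c.
have -> : \int[mu]_x0 Re (cis (dotv x x0) * g x0) =
    cos_transform (fun y => Re (g y)) x - sin_transform (fun y => Im (g y)) x.
  rewrite -RintegralB//; [|exact: integrable_cos_mul|exact: integrable_sin_mul].
  by apply: eq_Rintegral => y _; rewrite ReM.
have -> : \int[mu]_x0 Im (cis (dotv x x0) * g x0) =
    cos_transform (fun y => Im (g y)) x + sin_transform (fun y => Re (g y)) x.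
  rewrite -RintegralD//; [|exact: integrable_cos_mul|exact: integrable_sin_mul].
  by apply: eq_Rintegral => y _; rewrite ImM.
apply/eqP; rewrite eq_complex ReM ImM /=.
by rewrite !mul0r subr0 addr0 !eqxx.
Qed.

Lemma fourierE f xi : cintegrable f -> fourier f xi =
  (cos_transform (fun y => Re (f y)) xi + sin_transform (fun y =>
    Im (f y)) xi) +i*
  (cos_transform (fun y => Im (f y)) xi - sin_transform (fun y => Re (f y)) xi).
Proof.
move=> [ig1 ig2]; rewrite /fourier /cintegral; apply/eqP; rewrite eq_complex /=.
apply/andP; split; apply/eqP.
  rewrite -RintegralD//; [|exact: integrable_cos_mul|exact: integrable_sin_mul].
  by apply: eq_Rintegral => y _; rewrite ReM /= cosN sinN dotvC; ring.
rewrite -RintegralB//; [|exact: integrable_cos_mul|exact: integrable_sin_mul].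
by apply: eq_Rintegral => y _; rewrite ImM /= cosN sinN dotvC; ring.
Qed.

Lemma cintegrable_cmeasurable g : cintegrable g -> cmeasurable g.
Proof. by move=> [i1 i2]; split;
  [exact: integrable_measurable i1|exact: integrable_measurable i2]. Qed.

Lemma cmeasurable_inv_fourier g : cintegrable g -> cmeasurable (inv_fourier g).
Proof.
move=> ig; have [i1 i2] := ig; split; under eq_fun do rewrite inv_fourierE//=.
- apply: measurable_funM => //; apply: measurable_funB.
  + exact: measurable_cos_transform.
  + exact: measurable_sin_transform.
- apply: measurable_funM => //; apply: measurable_funD.
  + exact: measurable_cos_transform.
  + exact: measurable_sin_transform.
Qed.

Lemma cmeasurable_fourier g : cintegrable g -> cmeasurable (fourier g).
Proof.
move=> ig; have [i1 i2] := ig; split; under eq_fun do rewrite fourierE//=.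
- apply: measurable_funD.
  + exact: measurable_cos_transform.
  + exact: measurable_sin_transform.
- apply: measurable_funB.
  + exact: measurable_cos_transform.
  + exact: measurable_sin_transform.
Qed.

Lemma measurable_sqn g : cmeasurable g ->
  measurable_fun setT (fun x => sqn (g x)).
Proof. by move=> [m1 m2]; apply: measurable_funD; exact: measurable_funX. Qed.

(** The cosine and sine transforms of the real and imaginary parts of g are
    treated separately; the factor 2 comes from expanding the squares of their
    sums. *)
Lemma inv_fourier_sqn_le g : cintegrable g ->
  (\int[mu]_x (sqn (inv_fourier g x))%:E <=
   (2 * c)%:E * \int[mu]_xi (sqn (g xi))%:E)%E.
Proof.
move=> ig; have [i1 i2] := ig; have [m1 m2] := cintegrable_cmeasurable ig.
pose g1 y := Re (g y); pose g2 y := Im (g y).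
pose Q (h : rV -> R) x := cos_transform h x ^+ 2 + sin_transform h x ^+ 2.
have mQ h : mu.-integrable setT (EFin \o h) -> measurable_fun setT (Q h).
  move=> ih; apply: measurable_funD; apply: measurable_funX.
  - exact: measurable_cos_transform.
  - exact: measurable_sin_transform.
have Q0 h x : 0 <= Q h x by rewrite addr_ge0// sqr_ge0.
have pos : 0 < (2 * pi) ^+ n :> R by rewrite exprn_gt0// mulr_gt0// pi_gt0.
have c0 : 0 < c by rewrite invr_gt0.
have mQ1 := mQ _ i1; have mQ2 := mQ _ i2.
apply: (@le_trans _ _ ((2 * c ^+ 2)%:E * (\int[mu]_x (Q g1 x)%:E + \int[mu]_x
  (Q g2 x)%:E))%E).
  rewrite -ge0_integralD//=; last 4 first.
  - by move=> x _; rewrite lee_fin.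
  - exact/measurable_EFinP.
  - by move=> x _; rewrite lee_fin.
  - exact/measurable_EFinP.
  rewrite -ge0_integralZl//=; last 3 first.
  - by apply: emeasurable_funD; exact/measurable_EFinP.
  - by move=> x _; rewrite -EFinD lee_fin addr_ge0.
  - by rewrite lee_fin mulr_ge0// sqr_ge0.
  apply: ge0_le_integral => //.
  - by move=> x _; rewrite lee_fin sqn_ge0.
  - by apply/measurable_EFinP; apply: measurable_sqn;
      exact: cmeasurable_inv_fourier.
  - apply: emeasurable_funM => //.
    by apply: emeasurable_funD; exact/measurable_EFinP.
  - move=> x _; rewrite -EFinD -EFinM lee_fin inv_fourierE// /sqn /=.
    rewrite -/g1 -/g2 /Q; move: (cos_transform g1 x) (sin_transform g1 x)
      (cos_transform g2 x) (sin_transform g2 x) => C1 S1 C2 S2.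
    rewrite (_ : _ + _ = c ^+ 2 * ((C1 - S2) ^+ 2 + (C2 + S1) ^+ 2));
      last by ring.
    rewrite (_ : 2 * c ^+ 2 * _ = c ^+ 2 * (2 * (C1 ^+ 2 + S1 ^+ 2 + (C2 ^+ 2
      + S2 ^+ 2))));
      last by ring.
    apply: ler_wpM2l; first exact: sqr_ge0.
    by have := sqr_ge0 (C1 + S2); have := sqr_ge0 (C2 - S1); nra.
have b1 := bessel_inequality i1; have b2 := bessel_inequality i2.
apply: (@le_trans _ _ ((2 * c ^+ 2)%:E * (((2 * pi) ^+ n)%:E * \int[mu]_x (g1
  x ^+ 2)%:E
    + ((2 * pi) ^+ n)%:E * \int[mu]_x (g2 x ^+ 2)%:E))%E).
  by apply: lee_wpmul2l; [rewrite lee_fin mulr_ge0// sqr_ge0|exact: leeD].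
have mg12 : measurable_fun setT (fun x => g1 x ^+ 2) by exact: measurable_funX.
have mg22 : measurable_fun setT (fun x => g2 x ^+ 2) by exact: measurable_funX.
rewrite -ge0_muleDr; try by apply: integral_ge0 => x _; rewrite lee_fin sqr_ge0.
rewrite muleA -EFinM -ge0_integralD//=; last 4 first.
- by move=> x _; rewrite lee_fin sqr_ge0.
- exact/measurable_EFinP.
- by move=> x _; rewrite lee_fin sqr_ge0.
- exact/measurable_EFinP.
rewrite (_ : 2 * c ^+ 2 * _ = 2 * c)//.
by rewrite /c; field; rewrite gt_eqF.
Qed.

(** The kernel cos (x . y) is symmetric and bounded, so that Fubini moves it
    from one factor to the other. *)
Lemma pairing_cos (p q : rV -> R) :
  mu.-integrable setT (EFin \o p) -> mu.-integrable setT (EFin \o q) ->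
  \int[mu]_x (p x * cos_transform q x) = \int[mu]_x (cos_transform p x * q x).
Proof.
move=> ip iq; have mp := integrable_measurable ip;
  have mq := integrable_measurable iq.
pose F (z : rV * rV) := p z.1 * (cos (dotv z.1 z.2) * q z.2).
have mF : measurable_fun setT F.
  apply: measurable_funM; first exact: measurableT_comp.
  by apply: measurable_funM; [exact: measurable_cos_dotv|exact:
    measurableT_comp].
transitivity (\int[mu]_x \int[mu]_y F (x, y)).
  by apply: eq_Rintegral => x _; rewrite -RintegralZl//;
    exact: integrable_cos_mul.
rewrite (@Rintegral_swap _ _ _ _ R mu mu F p q)//; last first.
  move=> x y; rewrite /F /= !normrM ler_wpM2l// -[leRHS]mul1r ler_wpM2r//.
  exact: cos_max.
apply: eq_Rintegral => y _; rewrite -RintegralZr//;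
  last exact: integrable_cos_mul.
by apply: eq_Rintegral => x _; rewrite /F /= dotvC; ring.
Qed.

Lemma pairing_sin (p q : rV -> R) :
  mu.-integrable setT (EFin \o p) -> mu.-integrable setT (EFin \o q) ->
  \int[mu]_x (p x * sin_transform q x) = \int[mu]_x (sin_transform p x * q x).
Proof.
move=> ip iq; have mp := integrable_measurable ip;
  have mq := integrable_measurable iq.
pose F (z : rV * rV) := p z.1 * (sin (dotv z.1 z.2) * q z.2).
have mF : measurable_fun setT F.
  apply: measurable_funM; first exact: measurableT_comp.
  by apply: measurable_funM; [exact: measurable_sin_dotv|exact:
    measurableT_comp].
transitivity (\int[mu]_x \int[mu]_y F (x, y)).
  by apply: eq_Rintegral => x _; rewrite -RintegralZl//;
    exact: integrable_sin_mul.
rewrite (@Rintegral_swap _ _ _ _ R mu mu F p q)//; last first.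
  move=> x y; rewrite /F /= !normrM ler_wpM2l// -[leRHS]mul1r ler_wpM2r//.
  exact: sin_max.
apply: eq_Rintegral => y _; rewrite -RintegralZr//;
  last exact: integrable_sin_mul.
by apply: eq_Rintegral => x _; rewrite /F /= dotvC; ring.
Qed.

(** The inverse Fourier transform of an integrable function in the sense of
    distributions is its pointwise inverse transform. *)
Lemma inv_fourier_pairing g phi : cintegrable g -> cintegrable phi ->
  cintegral (fun xi => g xi * inv_fourier phi xi) =
  cintegral (fun x => inv_fourier g x * phi x).
Proof.
move=> ig ip; have [A B] := ig; have [P Q] := ip.
have ct (p q : rV -> R) : mu.-integrable setT (EFin \o p) ->
  mu.-integrable setT (EFin \o q) ->
    mu.-integrable setT (EFin \o (fun x => cos_transform q x * p x)).
  move=> Ip Iq; apply: (integrable_bounded_mul _ (cos_transform_le Iq) Ip).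
  exact: measurable_cos_transform.
have st (p q : rV -> R) : mu.-integrable setT (EFin \o p) ->
  mu.-integrable setT (EFin \o q) ->
    mu.-integrable setT (EFin \o (fun x => sin_transform q x * p x)).
  move=> Ip Iq; apply: (integrable_bounded_mul _ (sin_transform_le Iq) Ip).
  exact: measurable_sin_transform.
have comm (p q : rV -> R) : mu.-integrable setT (EFin \o (fun x =>
  p x * q x)) ->
    mu.-integrable setT (EFin \o (fun x => q x * p x)).
  by rewrite (_ : EFin \o (fun x => p x * q x) = EFin \o (fun x =>
    q x * p x))//;
    apply/funext => x /=; rewrite mulrC.
pose a x := Re (g x); pose b x := Im (g x); pose p x := Re (phi x);
  pose q x := Im (phi x).
apply/eqP; rewrite eq_complex; apply/andP; split; apply/eqP => /=.
- transitivity (\int[mu]_x (c * (a x * cos_transform p x) + (- c) * (a x *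
    sin_transform q x) +
    ((- c) * (b x * cos_transform q x) + (- c) * (b x * sin_transform p x)))).
    by apply: eq_Rintegral => x _; rewrite ReM inv_fourierE//= /a /b /p /q;
      ring.
  transitivity (\int[mu]_x (c * (cos_transform a x * p x) + (- c) *
    (sin_transform a x * q x) +
    ((- c) * (cos_transform b x * q x) + (- c) * (sin_transform b x * p
      x)))); last first.
    by apply: eq_Rintegral => x _; rewrite ReM inv_fourierE//= /a /b /p /q;
      ring.
  rewrite Rintegral_lin4;
    [|exact/comm/ct|exact/comm/st|exact/comm/ct|exact/comm/st].
  rewrite [RHS]Rintegral_lin4; [|exact: ct|exact: st|exact: ct|exact: st].
  by rewrite !pairing_cos// !pairing_sin.
- transitivity (\int[mu]_x (c * (a x * cos_transform q x) + c * (a x *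
    sin_transform p x) +
    (c * (b x * cos_transform p x) + (- c) * (b x * sin_transform q x)))).
    by apply: eq_Rintegral => x _; rewrite ImM inv_fourierE//= /a /b /p /q;
      ring.
  transitivity (\int[mu]_x (c * (cos_transform a x * q x) + c *
    (sin_transform a x * p x) +
    (c * (cos_transform b x * p x) + (- c) * (sin_transform b x * q x))));
      last first.
    by apply: eq_Rintegral => x _; rewrite ImM inv_fourierE//= /a /b /p /q;
      ring.
  rewrite Rintegral_lin4;
    [|exact/comm/ct|exact/comm/st|exact/comm/ct|exact/comm/st].
  rewrite [RHS]Rintegral_lin4; [|exact: ct|exact: st|exact: ct|exact: st].
  by rewrite !pairing_cos// !pairing_sin.
Qed.

End ComplexFourier.

(** * From integrable multipliers to L^2 bounds *)

Section MultiplierBound.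
Context {R : realType} {n : nat}.
Local Notation mu := (@lebesgue_rV R n).
Local Notation rV := 'rV[R]_n.
Local Notation Re := complex.Re.
Local Notation Im := complex.Im.
Local Open Scope complex_scope.
Implicit Types f g phi u : rV -> R[i].
Let c : R := ((2 * pi) ^+ n)^-1.

Lemma cmeasurableM f g : cmeasurable f -> cmeasurable g ->
  cmeasurable (fun x => f x * g x).
Proof.
move=> [f1 f2] [g1 g2]; split.
- under eq_fun do rewrite ReM.
  by apply: measurable_funB; exact: measurable_funM.
- under eq_fun do rewrite ImM.
  by apply: measurable_funD; exact: measurable_funM.
Qed.

Lemma cintegrable_normc_dom f (G : rV -> R) :
  cmeasurable f -> mu.-integrable setT (EFin \o G) ->
  (forall x, Normc.normc (f x) <= G x) -> cintegrable f.
Proof.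
move=> [m1 m2] iG fG; split.
- apply: (le_integrable_real m1 _ iG) => x.
  by rewrite (le_trans (Re_le_normc _))// (le_trans (fG x))// ler_norm.
- apply: (le_integrable_real m2 _ iG) => x.
  by rewrite (le_trans (Im_le_normc _))// (le_trans (fG x))// ler_norm.
Qed.

Lemma measurable_normc f : cmeasurable f ->
  measurable_fun setT (fun x => Normc.normc (f x)).
Proof.
move=> mf; under eq_fun do rewrite normc_sqrt.
apply: (measurableT_comp (f := @Num.sqrt R)); last exact: measurable_sqn.
by apply: continuous_measurable_fun; exact: sqrt_continuous.
Qed.

Lemma normc_ge0 (z : R[i]) : 0 <= Normc.normc z.
Proof. by rewrite normc_sqrt sqrtr_ge0. Qed.

Lemma normcM (z z' : R[i]) :
  Normc.normc (z * z') = Normc.normc z * Normc.normc z'.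
Proof. by rewrite !normc_sqrt sqnM sqrtrM// sqn_ge0. Qed.

Lemma cintegrable_normc f : cintegrable f ->
  mu.-integrable setT (EFin \o (fun x => Normc.normc (f x))).
Proof.
move=> [i1 i2]; have [m1 m2] := cintegrable_cmeasurable (conj i1 i2).
apply: (@le_integrable_real R _ _ mu _ (fun x =>
  1 * `|Re (f x)| + 1 * `|Im (f x)|)).
- exact: measurable_normc.
- move=> x; rewrite !mul1r (ger0_norm (normc_ge0 _)).
  by rewrite (le_trans (normc_le _))// ler_norm.
- by apply: integrable_lin2;
    [exact: (integrable_abse i1)|exact: (integrable_abse i2)].
Qed.

Lemma cintegrable_bounded_mul f g M : cmeasurable f ->
  (forall x, Normc.normc (f x) <= M) ->
  cintegrable g -> cintegrable (fun x => f x * g x).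
Proof.
move=> mf fM ig; apply: (@cintegrable_normc_dom _ (fun x =>
  M * Normc.normc (g x))).
- by apply: cmeasurableM => //; exact: cintegrable_cmeasurable.
- by apply: integrable_scale; exact: cintegrable_normc.
- by move=> x; rewrite normcM ler_wpM2r// normc_ge0.
Qed.

Lemma cintegralB f g : cintegrable f -> cintegrable g ->
  cintegral f - cintegral g = cintegral (fun x => f x - g x).
Proof.
move=> [f1 f2] [g1 g2]; apply/eqP; rewrite eq_complex ReB ImB /=.
rewrite -!RintegralB//; apply/andP; split; apply/eqP;
  apply: eq_Rintegral => x _.
- by rewrite ReB.
- by rewrite ImB.
Qed.

Lemma cintegrableB f g : cintegrable f -> cintegrable g ->
  cintegrable (fun x => f x - g x).
Proof.
move=> [f1 f2] [g1 g2]; split.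
- have := integrable_lin2 1 (-1) f1 g1; congr (_.-integrable _ _).
  by apply/funext => x /=; rewrite ReB mul1r mulN1r.
- have := integrable_lin2 1 (-1) f2 g2; congr (_.-integrable _ _).
  by apply/funext => x /=; rewrite ImB mul1r mulN1r.
Qed.

Lemma Lpnorm1_fin u : cintegrable u ->
  Lpnorm 1%E u = (\int[mu]_x Normc.normc (u x))%:E.
Proof.
move=> iu; rewrite /Lpnorm Lnorm1 /Rintegral fineK; last first.
  exact: integrable_fin_num (cintegrable_normc iu).
by apply: eq_integral => x _ /=; rewrite ger0_norm// normc_ge0.
Qed.

Lemma normc_fourier_le u xi : cintegrable u ->
  Normc.normc (fourier u xi) <= 4 * \int[mu]_x Normc.normc (u x).
Proof.
move=> iu; have [i1 i2] := iu; apply: (le_trans (normc_le _)).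
rewrite fourierE//=.
have := cos_transform_le i1 xi; have := cos_transform_le i2 xi.
have := sin_transform_le i1 xi; have := sin_transform_le i2 xi.
set N := (X in 4 * X).
have N1 : \int[mu]_x `|Re (u x)| <= N.
  apply: le_Rintegral => //; [exact: (integrable_abse i1)|exact:
    cintegrable_normc|].
  by move=> x _; exact: Re_le_normc.
have N2 : \int[mu]_x `|Im (u x)| <= N.
  apply: le_Rintegral => //; [exact: (integrable_abse i2)|exact:
    cintegrable_normc|].
  by move=> x _; exact: Im_le_normc.
move=> h1 h2 h3 h4.
apply: (le_trans (lerD (ler_normD _ _) (ler_normB _ _))).
lra.
Qed.

Lemma Lpnorm2E f : Lpnorm 2%:E f = ((\int[mu]_x (sqn (f x))%:E) `^ (2^-1))%E.
Proof.
rewrite /Lpnorm unlock; congr (_ `^ _)%E; apply: eq_integral => x _ /=.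
rewrite ger0_norm ?normc_ge0// normc_sqrt.
by rewrite powR_mulrn ?sqrtr_ge0// sqr_sqrtr// sqn_ge0.
Qed.

Lemma cmeasurableB f g : cmeasurable f -> cmeasurable g ->
  cmeasurable (fun x => f x - g x).
Proof.
move=> [f1 f2] [g1 g2]; split.
- by under eq_fun do rewrite ReB; exact: measurable_funB.
- by under eq_fun do rewrite ImB; exact: measurable_funB.
Qed.

Lemma inv_fourier_bounded phi : cintegrable phi ->
  exists M, forall x, Normc.normc (inv_fourier phi x) <= M.
Proof.
move=> ip; have [i1 i2] := ip.
exists (`|c| * (2 * (\int[mu]_x `|Re (phi x)| + \int[mu]_x `|Im (phi x)|)))
  => x.
apply: (le_trans (normc_le _));
  rewrite inv_fourierE//= !normrM -mulrDr ler_wpM2l//.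
have := cos_transform_le i1 x; have := cos_transform_le i2 x.
have := sin_transform_le i1 x; have := sin_transform_le i2 x => h1 h2 h3 h4.
apply: (le_trans (lerD (ler_normB _ _) (ler_normD _ _))).
lra.
Qed.

(** The difference of multipliers is bounded in L^2 only through its own
    squared integral; the integrability of each of them serves to make both
    distributions integrals that can be subtracted. The constant collects 2 (2
    pi)^-n from [inv_fourier_sqn_le] and 4^2 from [normc_fourier_le]. *)
Theorem multiplier_L1_L2_bound (k1 k2 : rV -> R[i]) (B : R) u :
  cintegrable k1 -> cintegrable k2 -> cintegrable u ->
  (forall phi : rV -> R[i], schwartz phi -> cintegrable phi) ->
  (\int[mu]_xi (sqn (k1 xi - k2 xi))%:E <= B%:E)%E ->
  (L2norm_distr (fun phi =>
     inv_fourier_distr (fun xi => k1 xi * fourier u xi) phi -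
     inv_fourier_distr (fun xi => k2 xi * fourier u xi) phi)%R <=
   (Num.sqrt (32 * c * B))%:E * Lpnorm 1%E u)%E.
Proof.
move=> i1 i2 iu schi kB.
have mu1 := cmeasurable_fourier iu.
pose N := \int[mu]_x Normc.normc (u x).
have N0 : 0 <= N by apply: Rintegral_ge0 => x _; exact: normc_ge0.
have uN xi : Normc.normc (fourier u xi) <= 4 * N by exact: normc_fourier_le.
have ig k : cintegrable k -> cintegrable (fun xi => k xi * fourier u xi).
  move=> ik; rewrite (_ : (fun xi => _) = (fun xi => fourier u xi * k xi)).
    exact: cintegrable_bounded_mul uN ik.
  by apply/funext => xi; rewrite mulrC.
pose g xi := k1 xi * fourier u xi - k2 xi * fourier u xi.
have igg : cintegrable g by apply: cintegrableB; exact: ig.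
have mg := cintegrable_cmeasurable igg.
have c0 : 0 < c by rewrite invr_gt0 exprn_gt0// mulr_gt0// pi_gt0.
have mk : measurable_fun setT (fun xi => sqn (k1 xi - k2 xi)).
  by apply: measurable_sqn; apply: cmeasurableB; exact: cintegrable_cmeasurable.
have B0 : 0 <= B.
  rewrite -lee_fin; apply: le_trans kB; apply: integral_ge0 => x _.
  by rewrite lee_fin sqn_ge0.
have vB : (\int[mu]_x (sqn (inv_fourier g x))%:E <= (32 * c * B * N ^+ 2)%:E)%E.
  apply: (le_trans (inv_fourier_sqn_le igg)).
  rewrite (_ : 32 * c * B * N ^+ 2 = 2 * c * (16 * N ^+ 2 * B)); last by ring.
  rewrite [leRHS]EFinM; apply: lee_wpmul2l;
    first by rewrite lee_fin mulr_ge0// ltW.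
  apply: (@le_trans _ _ ((16 * N ^+ 2)%:E * \int[mu]_xi (sqn (k1 xi - k2
    xi))%:E)%E); last first.
    by rewrite [leRHS]EFinM lee_wpmul2l// lee_fin mulr_ge0// sqr_ge0.
  rewrite -ge0_integralZl//=; last 3 first.
  - exact/measurable_EFinP.
  - by move=> x _; rewrite lee_fin sqn_ge0.
  - by rewrite lee_fin mulr_ge0// sqr_ge0.
  apply: ge0_le_integral => //.
  - by move=> x _; rewrite lee_fin sqn_ge0.
  - by apply/measurable_EFinP; exact: measurable_sqn.
  - by apply/measurable_EFinP; exact: measurable_funM.
  move=> x _; rewrite -EFinM lee_fin /g -mulrBl sqnM mulrC ler_wpM2r ?sqn_ge0//.
  have := uN x; rewrite normc_sqrt => h.
  rewrite -(sqr_sqrtr (sqn_ge0 (fourier u x))) (_ :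
    16 * N ^+ 2 = (4 * N) ^+ 2); last by ring.
  by rewrite lerXn2r ?nnegrE ?sqrtr_ge0// mulr_ge0.
have L2v : (Lpnorm 2%:E (inv_fourier g) <= (Num.sqrt (32 * c * B))%:E *
  Lpnorm 1%E u)%E.
  rewrite Lpnorm2E Lpnorm1_fin// -/N.
  apply: (@le_trans _ _ ((32 * c * B * N ^+ 2)%:E `^ (2^-1))%E).
    apply: gt0_ler_poweR => //.
    - by rewrite in_itv /= leey andbT integral_ge0// => x _;
        rewrite lee_fin sqn_ge0.
    - by rewrite in_itv /= leey andbT lee_fin !mulr_ge0// ?sqr_ge0// ltW.
  rewrite poweR_EFin -EFinM lee_fin powR12_sqrt ?mulr_ge0 ?sqr_ge0 ?(ltW c0)//.
  by rewrite sqrtrM ?mulr_ge0 ?(ltW c0)// sqrtr_sqr ger0_norm.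
apply: le_trans L2v; apply: ereal_inf_lbound; exists (inv_fourier g) => //;
  split.
- exact: cmeasurable_inv_fourier.
- rewrite Lpnorm2E; apply: poweR_lty; exact: le_lt_trans vB (ltry _).
move=> phi /schi iphi.
have [M phiM] := inv_fourier_bounded iphi.
have mphi := cmeasurable_inv_fourier iphi.
have igp k : cintegrable k ->
  cintegrable (fun xi => k xi * fourier u xi * inv_fourier phi xi).
  move=> ik; rewrite (_ : (fun xi => _) = (fun xi =>
    inv_fourier phi xi * (k xi * fourier u xi))).
    by apply: cintegrable_bounded_mul phiM _ => //; exact: ig.
  by apply/funext => xi; rewrite mulrC.
rewrite -inv_fourier_pairing// /inv_fourier_distr cintegralB;
  [|exact: igp|exact: igp].
by congr cintegral; apply/funext => xi; rewrite /g mulrBl.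
Qed.

End MultiplierBound.

(** * Integrability from polynomial decay *)

Section PolynomialDecay.
Context {R : realType} {n : nat}.
Local Notation mu := (@lebesgue_rV R n).
Local Notation rV := 'rV[R]_n.

(** The function is compared with the product of the 1 / (1 + x_i^2), that is,
    up to a constant, with the Poisson kernel at e = 1. This uses the bound of
    the product of the 1 + x_i^2 by 2^n max (1, |x|^(2n)). *)
Lemma integrable_poly_decay (f : rV -> R) (A B : R) : measurable_fun setT f ->
  (forall x, `|f x| <= A) -> (forall x, `|x| ^+ (2 * n) * `|f x| <= B) ->
  mu.-integrable setT (EFin \o f).
Proof.
move=> mf fA fB.
pose P x := poisson 1 (0 - x : rV).
have P0 x : 0 <= P x by exact: poisson_ge0.
apply: (@le_integrable_real R _ _ mu _ (fun x => (A + B) * P x)) => //.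
  move=> x; apply: le_trans (ler_norm _).
  pose D := \prod_(i < n) (1 + x ord0 i ^+ 2).
  have D0 : 0 < D by apply: prodr_gt0 => i _; rewrite ltr_pwDl ?sqr_ge0.
  have PD : P x = 2 ^+ n / D.
    rewrite /P /poisson; under eq_bigr do rewrite !mxE sub0r sqrrN expr1n mulr1.
    by rewrite big_split /= prodr_const card_ord prodfV.
  have D2 : D <= 2 ^+ n * Num.max 1 (`|x| ^+ (2 * n)).
    have -> : 2 ^+ n * Num.max 1 (`|x| ^+ (2 * n)) = \prod_(i < n) (2 *
      Num.max 1 (`|x| ^+ 2)).
      rewrite prodr_const card_ord exprMn; congr (_ * _).
      rewrite exprM; have [x1|x1] := leP 1 (`|x| ^+ 2).
        by rewrite !max_r// exprn_ege1.
      by rewrite !max_l ?expr1n// ?(ltW x1)// exprn_ile1// ?exprn_ge0// ltW.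
    apply: ler_prod => i _; rewrite addr_ge0 ?sqr_ge0//=.
    have xi : x ord0 i ^+ 2 <= `|x| ^+ 2.
      rewrite -(real_normK (num_real (x ord0 i))) lerXn2r ?nnegrE//.
      exact: (normr_rV_le x (normr_ge0 x)).1.
    have [h|h] := leP 1 (`|x| ^+ 2); lra.
  rewrite PD mulrA ler_pdivlMr//;
    apply: (le_trans (ler_wpM2l (normr_ge0 _) D2)).
  rewrite mulrCA (mulrC (A + B)) ler_wpM2l ?exprn_ge0//.
  have A0 : 0 <= A := le_trans (normr_ge0 _) (fA x).
  have B0 : 0 <= B by apply: le_trans (fB x); rewrite mulr_ge0// exprn_ge0.
  have := fA x; have := fB x; rewrite (mulrC (_ ^+ _)).
  have [h|h] := leP 1 (`|x| ^+ (2 * n)); first lra.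
  by rewrite mulr1; lra.
apply: integrable_scale; apply/integrableP; split.
  by apply/measurable_EFinP; exact: measurable_poisson_sub.
under eq_integral => x _ do rewrite /= ger0_norm//.
by rewrite integral_poisson_sub// ltry.
Qed.

Lemma normr_le_enorm (x : rV) : `|x| <= enorm x.
Proof.
apply/normr_rV_le; first exact: sqrtr_ge0.
move=> i; rewrite -sqrtr_sqr ler_wsqrtr// /dotv (bigD1 i)//= -expr2 lerDl.
by apply: sumr_ge0 => j _; rewrite -expr2 sqr_ge0.
Qed.

Lemma enorm_le (x : rV) : enorm x <= n%:R * `|x|.
Proof.
rewrite -[leRHS]ger0_norm ?mulr_ge0// -sqrtr_sqr ler_wsqrtr//.
apply: (@le_trans _ _ (n%:R * `|x| ^+ 2)).
  rewrite (_ : n%:R * _ = \sum_(i < n) `|x| ^+ 2); last first.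
    by rewrite sumr_const card_ord mulr_natl.
  apply: ler_sum => i _; rewrite -expr2 -(real_normK (num_real (x ord0 i))).
  rewrite lerXn2r ?nnegrE//; exact: (normr_rV_le x (normr_ge0 x)).1.
rewrite exprMn ler_wpM2r ?sqr_ge0// expr2 -natrM ler_nat.
by case: (n) => // m; rewrite leq_pmulr.
Qed.

Lemma mi_partial0 (f : rV -> R) : mi_partial (fun=> 0%N) f = f.
Proof. by rewrite /mi_partial; elim: (enum _) => //= i s ->. Qed.

Lemma smooth_continuous (f : rV -> R) : smooth_on setT f ->
  forall x, {for x, continuous f}.
Proof. by move=> /(_ 0%N) [cf _] x; exact: cf. Qed.

Lemma rapidly_decreasing_integrable (f : rV -> R) :
  smooth_on setT f -> rapidly_decreasing f -> mu.-integrable setT (EFin \o f).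
Proof.
move=> sf rf; have [A fA] := rf 0%N (fun=> 0%N);
  have [B fB] := rf (2 * n)%N (fun=> 0%N).
apply: (@integrable_poly_decay f A B).
- by apply: measurable_continuous_rV; exact: smooth_continuous.
- by move=> x; have := fA x; rewrite mi_partial0 expr0 mul1r.
- move=> x; have := fB x; rewrite mi_partial0; apply: le_trans.
  by rewrite ler_wpM2r// lerXn2r ?nnegrE ?sqrtr_ge0// normr_le_enorm.
Qed.

Lemma schwartz_cintegrable (phi : rV -> R[i]) : schwartz phi -> cintegrable phi.
Proof.
by move=> [[s1 s2] r1 r2]; split; exact: rapidly_decreasing_integrable.
Qed.

End PolynomialDecay.

(** * A lacunary sum of exponentials *)

Section DyadicSum.
Context {R : realType}.

(** The first K terms count for 1 each, and the others are dominated by a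
    geometric series. *)
Lemma sum_eventually_geometric (f : nat -> R) (K : nat) (r : R) :
  0 <= r < 1 -> (forall k, f k <= 1) -> (forall j, f (K + j)%N <= r ^+ j) ->
  forall N, \sum_(k < N) f k <= K%:R + (1 - r)^-1.
Proof.
move=> /andP[r0 r1]; elim: K f => [|K IH] f f1 fr N.
  apply: (@le_trans _ _ (\sum_(k < N) r ^+ k));
    first by apply: ler_sum => k _; exact: fr.
  have h : 0 < 1 - r by lra.
  rewrite add0r -[leRHS]mulr1 ler_pdivlMl//; have := subrX1 r N => e.
  have rN : 0 <= r ^+ N by exact: exprn_ge0.
  have -> : (1 - r) * \sum_(k < N) r ^+ k = 1 - r ^+ N by lra.
  lra.
case: N => [|N].
  by rewrite big_ord0 addr_ge0// invr_ge0; lra.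
rewrite big_ord_recl.
have := IH (fun k => f k.+1) (fun k => f1 _) (fun j => fr j) N.
have := f1 0%N; rewrite -[in K.+1%:R]natr1; under eq_bigr do rewrite /=; lra.
Qed.

(** A linear lower bound for the powers, which turns exponentials of geometric
    sequences into geometric sequences. *)
Lemma bernoulli_expr (q : R) (j : nat) : 1 < q -> j%:R * (q - 1) <= q ^+ j.
Proof.
move=> q1; elim: j => [|j IH]; first by rewrite mul0r expr0.
have qj : 1 <= q ^+ j by rewrite exprn_ege1// ltW.
rewrite exprS -natr1; nra.
Qed.

Lemma half_add_half_le (x y : R) : 0 <= x -> 1 <= y ->
  x / 2 + x / 2 * y <= x * y.
Proof. by move=> x0 y1; nra. Qed.

(** Half of each exponent is spent on the factor exp (- c t). Of the remaining
    terms, those with q^k t < 1 are about log (1/t) / log q in number, and the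
    later ones decrease geometrically at a rate independent of t. *)
Lemma dyadic_exp_sum (q b : R) : 1 < q -> 0 < b ->
  exists C c : R, [/\ 0 < C, 0 < c & forall t, 0 < t ->
    (\sum_(0 <= k <oo) (expR (- (b * q ^+ k * t)))%:E <=
     (C * (1 + Num.max (- ln t) 0) * expR (- (c * t)))%:E)%E].
Proof.
move=> q1 b0.
have lq : 0 < ln q by rewrite ln_gt0.
pose r := expR (- (b / 2 * (q - 1))).
have r01 : 0 <= r < 1.
  by rewrite expR_ge0/= expR_lt1 oppr_lt0 mulr_gt0 ?subr_gt0// divr_gt0.
have ir : 0 < (1 - r)^-1 by rewrite invr_gt0; move/andP: r01 => [_]; lra.
exists ((ln q)^-1 + 1 + (1 - r)^-1), (b / 2); split.
- by rewrite !addr_gt0// invr_gt0.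
- by rewrite divr_gt0.
move=> t t0; set L := Num.max _ _.
have L0 : 0 <= L by rewrite le_max lexx orbT.
(* the first index from which q^k t >= 1 is guaranteed *)
pose K := (Num.truncn (L / ln q)).+1.
have KL : L / ln q < K%:R by exact: truncnS_gt.
have KU : K%:R <= L / ln q + 1.
  by rewrite -natr1 lerD2r truncn_le divr_ge0// ltW.
have qK : 1 <= q ^+ K * t.
  rewrite -ler_pdivrMr// mul1r -ler_ln ?posrE ?invr_gt0 ?exprn_gt0//;
    last by lra.
  rewrite lnV ?posrE// lnXn; last by lra.
  rewrite -mulr_natl; apply: (@le_trans _ _ L); first by rewrite le_max lexx.
  by rewrite -ler_pdivrMr// ltW.
have qk k : 1 <= q ^+ k by rewrite exprn_ege1// ltW.
move: K KL KU qK => K _ KU qK.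
apply: lime_le.
  by apply: is_cvg_nneseries => k _ _; rewrite lee_fin expR_ge0.
apply: nearW => N; rewrite sumEFin lee_fin big_mkord.
apply: (@le_trans _ _ (expR (- (b / 2 * t)) * \sum_(k < N) expR (- (b / 2 * q
  ^+ k * t)))).
  rewrite mulr_sumr; apply: ler_sum => k _; rewrite -expRD ler_expR.
  have -> : - (b / 2 * t) + - (b / 2 * q ^+ k * t) = - (b * t / 2 + b * t / 2
    * q ^+ k).
    by ring.
  rewrite lerN2 [leRHS]mulrAC.
  by apply: half_add_half_le; rewrite // mulr_ge0// ltW.
rewrite mulrC ler_wpM2r ?expR_ge0//.
apply: (@le_trans _ _ (K%:R + (1 - r)^-1)).
  apply: (@sum_eventually_geometric (fun k =>
    expR (- (b / 2 * q ^+ k * t)))) => // [k|j].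
    rewrite -expR0 ler_expR oppr_le0;
      have q0 : 0 <= q by rewrite ltW// (lt_trans ltr01).
    by rewrite !mulr_ge0 ?exprn_ge0 ?invr_ge0 ?(ltW b0) ?(ltW t0).
  rewrite -expRM_natl ler_expR mulrN lerN2.
  have h1 := bernoulli_expr j q1.
  rewrite exprD; have h2 : q ^+ j <= q ^+ K * q ^+ j * t.
    by rewrite mulrAC -[leLHS]mul1r ler_wpM2r// (le_trans ler01).
  have : 0 < b / 2 by rewrite divr_gt0.
  move: (b / 2) => B B0; rewrite mulrCA -mulrA ler_pM2l//.
  lra.
have : L / ln q <= (ln q)^-1 * (1 + L).
  by rewrite mulrC ler_wpM2l ?invr_ge0 ?(ltW lq)// lerDr.
nra.
Qed.

End DyadicSum.

(** * Pointwise bounds for the multiplier *)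

Section PointwiseMultiplier.
Context {R : realType} {n : nat}.
Variables (w a : 'rV[R]_n -> R).

(** The mean value theorem at 0. *)
Lemma normr_sin_le (x : R) : `|sin x| <= `|x|.
Proof.
wlog x0 : x / 0 <= x.
  move=> h; have [/h//|x0] := leP 0 x.
  by rewrite -normrN -[leRHS]normrN -sinN; apply: h; lra.
have [y _] : exists2 y, y \in `[0, x] & sin x - sin 0 = cos y * (x - 0).
  apply: MVT_segment => //.
  by apply: continuous_subspaceT; exact: continuous_sin.
rewrite sin0 !subr0 => ->; rewrite normrM -[leRHS]mul1r ler_wpM2r//.
exact: cos_max.
Qed.

Lemma normr_sinc_le1 (x : R) : `|sinc x| <= 1.
Proof.
rewrite /sinc; have [->|x0] := eqVneq x 0; first by rewrite invr0 mul0r normr0.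
by rewrite normrM normfV ler_pdivrMl ?normr_gt0// mulr1 normr_sin_le.
Qed.

Lemma measurable_inv : measurable_fun [set: R] (@GRing.inv R).
Proof.
rewrite -(setUv [set (0 : R)]); apply/measurable_funU => //;
  first exact: measurableC.
split; first exact: measurable_fun_set1.
apply: open_continuous_measurable_fun.
  by apply: closed_openC; exact: (accessible_closed_set1
    (hausdorff_accessible (@norm_hausdorff _ _))).
by move=> x; rewrite inE /= => /eqP x0; apply: continuousV => //; exact: cvg_id.
Qed.

(** In each regime the solution formula is t times an average of exponentials
    whose rates are at least d. In the overdamped regime the slower rate is (a
    - s) / 2 with s^2 = a^2 - 4 w^2, which is at least w^2 / a: this is the
    second hypothesis on d. *)
Lemma multiplier_le (t d : R) xi : 0 < w xi -> 0 < a xi -> 0 < t ->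
  d <= a xi / 2 -> d <= w xi ^+ 2 / a xi ->
  `|multiplier w a t xi| <= t * expR (- (d * t)).
Proof.
move=> w0 a0 t0 da dw; rewrite /multiplier; case: ifPn => [aw|].
  rewrite normrM (ger0_norm (expR_ge0 _)) mulrC; apply: ler_pM => //;
    rewrite ?expR_ge0//.
    rewrite normrM (gtr0_norm t0) -[leRHS]mulr1 ler_wpM2l ?(ltW t0)//.
    exact: normr_sinc_le1.
  by rewrite ler_expR lerN2 mulrAC ler_wpM2r// ltW.
rewrite -leNgt => wa; case: ifPn => [/eqP aw|aw].
  rewrite normrM (ger0_norm (expR_ge0 _)) gtr0_norm// ler_wpM2l ?(ltW t0)//.
  rewrite ler_expR lerN2 ler_wpM2r ?(ltW t0)//; lra.
set s := Num.sqrt _.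
have s0 : 0 < s.
  rewrite sqrtr_gt0 subr_gt0 lt_neqAle wa andbT.
  apply: contra aw => /eqP h; rewrite -(eqrXn2 (n := 2))// ?(ltW a0)//.
    by rewrite -h; apply/eqP; ring.
  by rewrite mulr_ge0// ltW.
have s2 : s ^+ 2 = a xi ^+ 2 - 4 * w xi ^+ 2 by rewrite sqr_sqrtr// subr_ge0.
set lp := (- a xi + s) / 2; set lm := (- a xi - s) / 2.
have lpm : lp - lm = s by rewrite /lp /lm; field.
have lpd : lp <= - d.
  have h : d * a xi <= w xi ^+ 2 by rewrite -ler_pdivlMr.
  have h2 : d * a xi * 4 <= a xi ^+ 2 - s ^+ 2 by rewrite s2; lra.
  rewrite /lp; suff : s <= a xi - 2 * d by lra.
  have ad : 0 <= a xi - 2 * d by lra.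
  rewrite -(ler_pXn2r (n := 2)) ?nnegrE ?(ltW s0)//.
  have := sqr_ge0 d; nra.
rewrite lpm ger0_norm; last first.
  by rewrite divr_ge0 ?(ltW s0)// subr_ge0 ler_expR ler_wpM2r ?(ltW t0)//; lra.
rewrite ler_pdivrMr//.
apply: (@le_trans _ _ (t * s * expR (lp * t))); last first.
  rewrite mulrAC ler_wpM2r ?(ltW s0)// ler_wpM2l ?(ltW t0)// ler_expR -mulNr.
  by rewrite ler_wpM2r ?(ltW t0).
have -> : expR (lm * t) = expR (lp * t) * expR (- (s * t)).
  by rewrite -expRD; congr expR; rewrite -lpm; ring.
have := expR_ge1Dx (- (s * t)); have := expR_gt0 (lp * t).
move: (expR _) (expR _) => X Y; nra.
Qed.

(** In the oscillating regime the sine is bounded by 1 instead of its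
    argument, which trades the factor t for 1 / w. The hypothesis keeps 1 -
    a^2 / (4 w^2) above 1/2. *)
Lemma multiplier_sqr_le (t : R) xi : 0 < w xi -> 0 < a xi -> 0 < t ->
  a xi ^+ 2 <= 2 * w xi ^+ 2 ->
  multiplier w a t xi ^+ 2 <= 2 / w xi ^+ 2 * expR (- (a xi * t)).
Proof.
move=> w0 a0 t0 aw; rewrite /multiplier.
have ww : 0 < w xi ^+ 2 by rewrite exprn_gt0.
rewrite ifT; last by lra.
set q := a xi ^+ 2 / (4 * w xi ^+ 2).
have q2 : q <= 1 / 2 by rewrite ler_pdivrMr; [lra|rewrite mulr_gt0].
set r := Num.sqrt (1 - q).
have r2 : r ^+ 2 = 1 - q by rewrite sqr_sqrtr; lra.
have r0 : 0 < r by rewrite sqrtr_gt0; lra.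
rewrite /sinc; set S := sin _.
have S1 : S ^+ 2 <= 1 by rewrite -(real_normK (num_real S)) exprn_ile1//
  sin_max.
have -> : (expR (- (a xi * t / 2)) * (t * ((t * w xi * r)^-1 * S))) ^+ 2 =
    expR (- (a xi * t)) * (S ^+ 2 / (w xi ^+ 2 * r ^+ 2)).
  have -> : expR (- (a xi * t)) = expR (- (a xi * t / 2)) ^+ 2.
    by rewrite -expRM_natl; congr expR; field.
  by field; rewrite !gt_eqF.
rewrite mulrC ler_wpM2r ?expR_ge0//.
rewrite ler_pdivrMr ?mulr_gt0 ?exprn_gt0// r2.
have -> : 2 / w xi ^+ 2 * (w xi ^+ 2 * (1 - q)) = 2 * (1 - q).
  by field; rewrite gt_eqF.
lra.
Qed.

Lemma measurable_multiplier t : measurable_fun setT w ->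
  measurable_fun setT a ->
  measurable_fun setT (multiplier w a t).
Proof.
move=> mw ma.
have mX (f : 'rV[R]_n -> R) : measurable_fun setT f ->
  measurable_fun setT (fun x => f x ^+ 2).
  by move=> mf; exact: measurable_funX.
have mE (f : 'rV[R]_n -> R) : measurable_fun setT f ->
  measurable_fun setT (fun x => expR (f x)).
  by move=> mf; apply: (measurableT_comp (f := @expR R)) => //;
    exact: measurable_expR.
have mS (f : 'rV[R]_n -> R) : measurable_fun setT f ->
  measurable_fun setT (fun x => Num.sqrt (f x)).
  move=> mf; apply: (measurableT_comp (f := @Num.sqrt R)) => //.
  by apply: continuous_measurable_fun; exact: sqrt_continuous.
have mI (f : 'rV[R]_n -> R) : measurable_fun setT f ->
  measurable_fun setT (fun x => (f x)^-1).
  by move=> mf; exact: (measurableT_comp measurable_inv).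
have mK (k : R) (f : 'rV[R]_n -> R) : measurable_fun setT f ->
  measurable_fun setT (fun x => k * f x).
  by move=> mf; exact: measurable_funM.
have mN (f : 'rV[R]_n -> R) : measurable_fun setT f ->
  measurable_fun setT (fun x => - f x).
  by move=> mf; exact: measurable_funN.
have mM (f g : 'rV[R]_n -> R) : measurable_fun setT f ->
  measurable_fun setT g -> measurable_fun setT (fun x => f x * g x).
  by move=> mf mg; exact: measurable_funM.
have mB (f g : 'rV[R]_n -> R) : measurable_fun setT f ->
  measurable_fun setT g -> measurable_fun setT (fun x => f x - g x).
  by move=> mf mg; exact: measurable_funB.
have mD (f g : 'rV[R]_n -> R) : measurable_fun setT f ->
  measurable_fun setT g -> measurable_fun setT (fun x => f x + g x).
  by move=> mf mg; exact: measurable_funD.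
have msin (f : 'rV[R]_n -> R) : measurable_fun setT f ->
  measurable_fun setT (fun x => sin (f x)).
  move=> mf; apply: (measurableT_comp (f := @sin R)) => //.
  by apply: continuous_measurable_fun; exact: continuous_sin.
have mc (k : R) : measurable_fun setT (fun _ : 'rV[R]_n =>
  k) by exact: measurable_cst.
rewrite /multiplier /sinc; apply: measurable_fun_ifT.
- by apply: measurable_fun_ltr; auto.
- by do ?[exact: mc|apply: (mB)|apply: (mM)|apply: (mE)|apply: (mN)|apply:
    (msin)|apply: (mI)|apply: (mS)|apply: (mX)].
apply: measurable_fun_ifT.
- by apply: measurable_fun_eqr; auto.
- by do ?[exact: mc|apply: (mM)|apply: (mE)|apply: (mN)].
- by do ?[exact: mc|apply: (mB)|apply: (mD)|apply: (mM)|apply: (mE)|apply: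
    (mN)|apply: (mI)|apply: (mS)|apply: (mX)].
Qed.

End PointwiseMultiplier.

(** * Integration over dyadic shells *)

Section DyadicIntegral.
Context {R : realType} {n : nat}.
Local Notation mu := (@lebesgue_rV R n).
Local Notation rV := 'rV[R]_n.

Lemma dyadic_index (y : R) : 1 <= y -> exists k, 2 ^+ k <= y <= 2 ^+ k.+1.
Proof.
move=> y1; pose m := Num.truncn y.
have m0 : (0 < m)%N by rewrite truncn_gt0.
have /andP[h1 h2] := trunc_log_bounds (isT : (1 < 2)%N) m0.
exists (trunc_log 2 m); apply/andP; split.
  rewrite -natrX; apply: (@le_trans _ _ m%:R); first by rewrite ler_nat.
  by rewrite truncn_le (le_trans ler01).
rewrite -natrX; apply: (@le_trans _ _ m.+1%:R); last by rewrite ler_nat.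
exact/ltW/truncnS_gt.
Qed.

Definition sup_ball (r : R) : set rV := [set x | `|x| <= r].

Lemma sup_ballE r : 0 <= r -> sup_ball r = [set x | forall i, `|x ord0 i| <= r].
Proof. by move=> r0; apply/seteqP; split => x /normr_rV_le; exact. Qed.

Lemma measurable_sup_ball r : 0 <= r -> measurable (sup_ball r).
Proof. by move=> r0; rewrite sup_ballE//; exact: measurable_sup_cube. Qed.

Lemma lebesgue_sup_ball r : 0 <= r -> mu (sup_ball r) = ((2 * r) ^+ n)%:E.
Proof. by move=> r0; rewrite sup_ballE//; exact: lebesgue_sup_cube. Qed.

Lemma integral_cst_sup_ball (c r : R) : 0 <= c -> 0 <= r ->
  (\int[mu]_x (c * \1_(sup_ball r) x)%:E = (c * (2 * r) ^+ n)%:E)%E.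
Proof.
move=> c0 r0; under eq_integral => x _ do rewrite EFinM.
rewrite ge0_integralZl//=.
- rewrite integral_indic//; last exact: measurable_sup_ball.
  by rewrite setIT EFinM; congr (_ * _)%E; exact: lebesgue_sup_ball.
- by apply/measurable_EFinP; apply: measurable_indic;
    exact: measurable_sup_ball.
Qed.

(** On the k-th shell the function is dominated by a multiple of the indicator
    of the ball of radius 2^(k+1), whose volume 4^n (2^k)^n absorbs the factor
    (2^k)^-n. *)
Lemma dyadic_integral_le (f : rV -> R) (A0 R0 X : R) (E : nat -> R) :
  measurable_fun setT f -> (forall x, 0 <= f x) -> 1 <= R0 -> 0 <= A0 ->
    0 <= X ->
  (forall k, 0 <= E k) ->
  (forall x, `|x| <= R0 -> f x <= A0) ->
  (forall k x, R0 <= `|x| -> 2 ^+ k <= `|x| <= 2 ^+ k.+1 ->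
     f x <= X * (2 ^+ k) ^- n * E k) ->
  (\int[mu]_x (f x)%:E <= (A0 * (2 * R0) ^+ n)%:E +
     (X * 4 ^+ n)%:E * \sum_(0 <= k <oo) (E k)%:E)%E.
Proof.
move=> mf f0 R1 A00 X0 E0 h0 h1.
have R00 : 0 <= R0 by rewrite (le_trans ler01).
have two k : 0 < 2 ^+ k :> R by rewrite exprn_gt0.
pose c k := X * (2 ^+ k) ^- n * E k.
have c0 k : 0 <= c k by rewrite mulr_ge0// mulr_ge0// invr_ge0 exprn_ge0// ltW.
pose g k (x : rV) : \bar R := (c k * \1_(sup_ball (2 ^+ k.+1)) x)%:E.
have g0 k x : (0 <= g k x)%E by rewrite lee_fin mulr_ge0.
have mg k : measurable_fun setT (g k).
  apply/measurable_EFinP; apply: measurable_funM => //.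
  by apply: measurable_indic; apply: measurable_sup_ball; exact: ltW.
pose h (x : rV) : \bar R := (A0 * \1_(sup_ball R0) x)%:E.
have mh : measurable_fun setT h.
  apply/measurable_EFinP; apply: measurable_funM => //.
  by apply: measurable_indic; exact: measurable_sup_ball.
have hh0 x : (0 <= h x)%E by rewrite lee_fin mulr_ge0.
have s0 x : (0 <= \sum_(0 <= k <oo) g k x)%E by apply: nneseries_ge0 => k _ _.
have ms : measurable_fun setT (fun x => \sum_(0 <= k <oo) g k x)%E.
  by apply: ge0_emeasurable_sum.
apply: (@le_trans _ _ (\int[mu]_x (h x + \sum_(0 <= k <oo) g k x))%E).
  apply: ge0_le_integral => //.
  - by move=> x _; rewrite lee_fin.
  - exact/measurable_EFinP.
  - exact: emeasurable_funD.
  move=> x _; have [xR|Rx] := leP `|x| R0.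
    apply: (@le_trans _ _ (h x)); last by rewrite leeDl.
    by rewrite /h lee_fin indicE mem_set//= mulr1 h0.
  have /dyadic_index[k kx] : 1 <= `|x| by rewrite (le_trans R1)// ltW.
  apply: (@le_trans _ _ (g k x)).
    rewrite /g lee_fin indicE mem_set/=; last by case/andP: kx.
    by rewrite mulr1 h1// ltW.
  apply: (@le_trans _ _ (\sum_(0 <= k <oo) g k x))%E; last by rewrite leeDr.
  rewrite (nneseriesD1 (n := k))//. rewrite leeDl// nneseries_ge0//.
rewrite ge0_integralD//= integral_cst_sup_ball// leeD2l//.
rewrite integral_nneseries//.
rewrite -nneseriesZl; last by move=> k _; rewrite lee_fin.
apply: lee_nneseries => [k _ _|k _]; first exact: integral_ge0.
rewrite integral_cst_sup_ball// ?(ltW (two _))//.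
rewrite -EFinM lee_fin /c (_ : 4 = 2 * 2 :> R); last by ring.
rewrite exprS !exprMn.
have p1 : 2 ^+ k ^+ n != 0 :> R by rewrite !expf_neq0.
by rewrite le_eqVlt; apply/orP; left; apply/eqP; field.
Qed.

End DyadicIntegral.

(** * Two elementary estimates *)

Section RealEstimates.
Context {R : realType}.

Lemma polynomial_exp_decay (N : nat) (th b : R) : 0 < th -> 0 < b ->
  exists M, forall y, 1 <= y -> y ^+ N * expR (- (b * y `^ th)) <= M.
Proof.
move=> th0 b0; pose m := Num.truncn (N%:R / th).
have mN : N%:R <= m.+1%:R * th by rewrite -ler_pdivrMr// ltW// truncnS_gt.
exists ((m.+1)`!%:R / b ^+ m.+1) => y y1.
have y0 : 0 < y by rewrite (lt_le_trans ltr01).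
have z0 : 0 < y `^ th by rewrite powR_gt0.
rewrite expRN ler_pdivrMr ?expR_gt0//.
apply: (@le_trans _ _ ((y `^ th) ^+ m.+1)).
  rewrite -!powR_mulrn ?(ltW y0) ?(ltW z0)// -powRrM ler_powR// mulrC //.
have bz : 0 <= b * y `^ th by rewrite mulr_ge0// ltW.
have := expR_ge1Dxn m bz; rewrite exprMn => h.
have bm : 0 < b ^+ m.+1 by rewrite exprn_gt0.
have f0 : 0 < (m.+1)`!%:R :> R by rewrite ltr0n fact_gt0.
rewrite mulrAC ler_pdivlMr// -ler_pdivrMl// mulrC (mulrC _ (b ^+ _)).
lra.
Qed.

(** Half of the exponential absorbs the factor t, at the cost of a constant of
    order 1 / d. *)
Lemma t_exp_le (t d : R) : 0 < t -> 0 < d ->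
  (t * expR (- (d * t))) ^+ 2 <= 4 / d ^+ 2 * expR (- (d * t)).
Proof.
move=> t0 d0.
have e2 : expR (- (d * t)) = expR (- (d * t / 2)) ^+ 2.
  by rewrite -expRM_natl; congr expR; field.
have h : t * expR (- (d * t / 2)) <= 2 / d.
  rewrite expRN ler_pdivrMr ?expR_gt0//.
  have := expR_ge1Dx (d * t / 2) => h; rewrite mulrC -ler_pdivrMr ?divr_gt0//.
  rewrite invf_div; apply: le_trans h; lra.
rewrite exprMn [X in _ * X]expr2 mulrA ler_wpM2r ?expR_ge0//.
rewrite e2 -exprMn (_ : 4 / d ^+ 2 = (2 / d) ^+ 2); last by field;
  rewrite gt_eqF.
by rewrite lerXn2r ?nnegrE ?mulr_ge0 ?expR_ge0 ?invr_ge0 ?(ltW t0) ?(ltW d0).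
Qed.

End RealEstimates.

(** * Uniform bounds for the symbols and the cutoff *)

Section Compactness.
Context {R : realType} {n : nat}.
Local Notation rV := 'rV[R]_n.

Lemma compact_annulus (r s : R) : compact [set x : rV | r <= `|x| <= s].
Proof.
apply: bounded_closed_compact.
  exists s; split; first exact: num_real.
  by move=> M sM x /= /andP[_ xs]; rewrite (le_trans xs)// ltW.
rewrite (_ : mkset _ = (fun x : rV => `|x|) @^-1` [set` `[r, s]]); last first.
  by apply/seteqP; split => x /=; rewrite in_itv.
apply: closed_comp => [x _|]; first exact: norm_continuous.
exact: interval_closed.
Qed.

Lemma positive_bounds_on_compact (A : set rV) (f : rV -> R) : compact A ->
  (forall x, A x -> {for x, continuous f}) -> (forall x, A x -> 0 < f x) ->
  exists m M, [/\ 0 < m, 0 < M & forall x, A x -> m <= f x <= M].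
Proof.
move=> cA cf f0; have [->|/set0P A0] := eqVneq A set0.
  by exists 1, 1; split.
have wf : {within A, continuous f}.
  by apply: continuous_in_subspaceT => x; rewrite inE => Ax; exact: cf.
have [y yA ymin] := compact_EVT_min A0 cA wf.
have [z zA zmax] := compact_EVT_max A0 cA wf.
exists (f y), (f z); split.
- by apply: f0; rewrite inE in yA.
- by apply: f0; rewrite inE in zA.
- by move=> x Ax; rewrite ymin ?zmax ?inE.
Qed.

(** Homogeneity reduces the bound to the unit sphere, which is compact. *)
Lemma homogeneous_lower_bound (sigma : R) (w : rV -> R) :
  (forall x, x != 0 -> {for x, continuous w}) ->
  (forall (r : R) (xi : rV), 0 < r -> xi != 0 ->
    w (r *: xi) = r `^ sigma * w xi) ->
  (forall xi : rV, xi != 0 -> 0 < w xi) ->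
  exists2 w0, 0 < w0 & forall xi : rV, xi != 0 -> w0 * `|xi| `^ sigma <= w xi.
Proof.
move=> cw hw w_gt0.
have nz (x : rV) : 1 <= `|x| <= 1 -> x != 0.
  by move=> /andP[x1 _]; rewrite -normr_gt0 (lt_le_trans ltr01).
have [m [M [m0 _ wm]]] := positive_bounds_on_compact (@compact_annulus 1 1)
  (fun x h => cw x (nz x h)) (fun x h => w_gt0 x (nz x h)).
exists m => // xi xi0; have nxi : 0 < `|xi| by rewrite normr_gt0.
have sph : 1 <= `| (`|xi|^-1) *: xi | <= 1.
  by rewrite normrZ gtr0_norm ?invr_gt0// mulVf ?gt_eqF// lexx.
have := wm _ sph; have -> : w xi = `|xi| `^ sigma * w (`|xi|^-1 *: xi).
  by rewrite -hw ?(nz _ sph)// scalerA divff ?gt_eqF// scale1r.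
by move=> /andP[h _]; rewrite mulrC ler_wpM2l// powR_ge0.
Qed.

(** Since a is O(|xi|^theta1) with theta1 < sigma, the restoring term
    dominates the damping for large frequencies. The radius R0 is chosen
    beyond the compact set K. *)
Lemma high_frequency_bounds (sigma theta1 a1 C : R)
  (w a : rV -> R) (K : set rV) :
  0 < theta1 -> theta1 < sigma -> 0 < a1 -> 0 < C -> compact K ->
  (forall x, x != 0 -> {for x, continuous w}) ->
  (forall (r : R) (xi : rV), 0 < r -> xi != 0 ->
    w (r *: xi) = r `^ sigma * w xi) ->
  (forall xi : rV, xi != 0 -> 0 < w xi) ->
  (forall xi : rV, xi != 0 -> ~ K xi -> a1 * enorm xi `^ theta1 <= a xi) ->
  (forall xi : rV, xi != 0 -> ~ K xi -> `|a xi| <= C * enorm xi `^ theta1) ->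
  exists R0 w0, [/\ 1 <= R0, 0 < w0 & forall xi, R0 <= `|xi| ->
    [/\ w0 * `|xi| `^ sigma <= w xi,
      a1 * `|xi| `^ theta1 <= a xi & a xi <= w xi] ].
Proof.
move=> th0 ths a10 C0 cK cw hw w_gt0 al au.
have [w0 w00 wlow] := homogeneous_lower_bound cw hw w_gt0.
have [N [_ KN]] := compact_bounded cK.
pose D := C * n%:R `^ theta1.
(* beyond the last radius, D |xi|^theta1 <= w0 |xi|^sigma *)
pose R0 := Num.max 1 (Num.max (N + 2) ((D / w0) `^ (sigma - theta1)^-1)).
exists R0, w0; split => //; first by rewrite le_max lexx.
move=> xi; rewrite !ge_max => /and3P[xi1 xiN xiD].
have nxi : 0 < `|xi| by rewrite (lt_le_trans ltr01).
have xi0 : xi != 0 by rewrite -normr_gt0.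
have nK : ~ K xi.
  move=> Kxi; have N1 : N < N + 1 by rewrite ltrDl.
  have := KN _ N1 _ Kxi; rewrite /= => h; lra.
have e0 : 0 <= enorm xi by exact: sqrtr_ge0.
split; first exact: wlow.
- apply: le_trans (al _ xi0 nK);
    rewrite ler_wpM2l ?(ltW a10)// ge0_ler_powR ?nnegrE ?(ltW th0)//.
  exact: normr_le_enorm.
- apply: le_trans (ler_norm _) _; apply: le_trans (au _ xi0 nK) _.
  apply: le_trans (wlow _ xi0).
  apply: (@le_trans _ _ (D * `|xi| `^ theta1)).
    rewrite /D -mulrA ler_wpM2l ?(ltW C0)// -powRM// ge0_ler_powR ?nnegrE
      ?mulr_ge0 ?(ltW th0)//.
    exact: enorm_le.
  rewrite (_ : sigma = (sigma - theta1) + theta1); last by ring.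
  rewrite powRD; last by apply/implyP => _; rewrite gt_eqF.
  rewrite mulrA ler_wpM2r ?powR_ge0// mulrC -ler_pdivrMr//.
  have D0 : 0 <= D / w0 by rewrite divr_ge0 ?(ltW w00)// mulr_ge0 ?powR_ge0//
    ltW.
  have st : 0 < sigma - theta1 by rewrite subr_gt0.
  rewrite -[leLHS]powRr1// -[X in _ `^ X <= _](mulVf (lt0r_neq0 st)) powRrM.
  by rewrite ge0_ler_powR ?nnegrE ?powR_ge0 ?(ltW st).
Qed.

Lemma test_function_bounded (chi : rV -> R[i]) : test_function chi ->
  exists M, forall x, Normc.normc (chi x) <= M.
Proof.
move=> [[s1 s2] [K [cK K0]]].
have bd (f : rV -> R) : smooth_on setT f -> exists M, forall x, K x ->
  `|f x| <= M.
  move=> sf; have cf := smooth_continuous sf.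
  have [N [_ fN]] : bounded_set (f @` K).
    apply: compact_bounded; apply: continuous_compact => //.
    by apply: continuous_subspaceT => x; exact: cf.
  exists (N + 1) => x Kx; apply: fN; first by rewrite ltrDl.
  by exists x.
have [M1 h1] := bd _ s1; have [M2 h2] := bd _ s2.
exists (Num.max 0 (M1 + M2)) => x; have [Kx|nKx] := pselect (K x).
  rewrite (le_trans (normc_le _))// le_max; apply/orP; right.
  by apply: lerD; [exact: h1|exact: h2].
by rewrite K0// normc_sqrt /sqn /= expr0n addr0 sqrtr0 le_max lexx.
Qed.

End Compactness.

Local Open Scope complex_scope.

(** * The multiplier away from the origin *)

Section HighFrequencyEstimate.
Context {R : realType} {n : nat}.
Local Notation mu := (@lebesgue_rV R n).
Local Notation rV := 'rV[R]_n.
Variables (sigma theta1 a1 R0 w0 : R) (w a : rV -> R).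
Hypothesis n_sigma : n%:R = 2 * sigma.
Hypothesis theta1_gt0 : 0 < theta1.
Hypothesis a1_gt0 : 0 < a1.
Hypothesis w_cont : forall x, x != 0 -> {for x, continuous w}.
Hypothesis a_cont : forall x, x != 0 -> {for x, continuous a}.
Hypothesis w_gt0 : forall xi : rV, xi != 0 -> 0 < w xi.
Hypothesis a_gt0 : forall xi : rV, xi != 0 -> 0 < a xi.
Hypothesis R0_ge1 : 1 <= R0.
Hypothesis w0_gt0 : 0 < w0.
Hypothesis high : forall xi, R0 <= `|xi| ->
  [/\ w0 * `|xi| `^ sigma <= w xi, a1 * `|xi| `^ theta1 <= a xi & a xi <= w xi].

Let nz (xi : rV) : R0 <= `|xi| -> xi != 0.
Proof. by move=> h; rewrite -normr_gt0 (lt_le_trans _ h)// (lt_le_trans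
  ltr01). Qed.

Lemma measurable_multiplier_punctured t :
  measurable_fun setT (multiplier w a t).
Proof. by apply: measurable_multiplier;
  exact: measurable_punctured_continuous. Qed.

Lemma multiplier_le_t t (xi : rV) : 0 < t -> xi != 0 ->
  `|multiplier w a t xi| <= t.
Proof.
move=> t0 xi0; rewrite -[leRHS]mulr1 -expR0 -oppr0 -[X in - X](mul0r t).
apply: multiplier_le; rewrite ?w_gt0 ?a_gt0//.
- by rewrite divr_ge0// ltW// a_gt0.
- by rewrite divr_ge0 ?sqr_ge0// ltW// a_gt0.
Qed.

(** Near the origin only |m| <= t is available, whatever the behaviour of a
    there. At infinity the exponential coming from the damping beats every
    power of |xi|. *)
Lemma integrable_multiplier t : 0 < t ->
  mu.-integrable setT (EFin \o multiplier w a t).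
Proof.
move=> t0; pose A := t + `|multiplier w a t 0|.
have mA xi : `|multiplier w a t xi| <= A.
  have [->|xi0] := eqVneq xi 0; first by rewrite lerDr ltW.
  by rewrite (le_trans (multiplier_le_t t0 xi0))// lerDl.
have R00 : 0 < R0 by rewrite (lt_le_trans ltr01).
have A0 : 0 <= A by rewrite addr_ge0// ltW.
(* below, d = a / 2 is admissible in multiplier_le because a <= w *)
have [M hM] := @polynomial_exp_decay R (2 * n) theta1 (a1 / 2 * t) theta1_gt0
  (mulr_gt0 (divr_gt0 a1_gt0 (ltr0n R 2)) t0).
apply: (@integrable_poly_decay R n _ A (R0 ^+ (2 * n) * A + t * `|M|)) => //.
  exact: measurable_multiplier_punctured.
move=> xi; have [xiR|Rxi] := leP `|xi| R0.
  rewrite -[leLHS]addr0 lerD//; last by rewrite mulr_ge0// ltW.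
  by apply: ler_pM => //; rewrite ?exprn_ge0// lerXn2r ?nnegrE// ltW.
have [_ alow aw] := high (ltW Rxi); have xi0 := nz (ltW Rxi).
have ax := a_gt0 xi0; have wx := w_gt0 xi0.
rewrite -[leLHS]add0r lerD//; first by rewrite mulr_ge0// exprn_ge0// ltW.
apply: (@le_trans _ _ (t * (`|xi| ^+ (2 * n) * expR (- (a1 / 2 * t * `|xi| `^
  theta1))))).
  rewrite mulrCA ler_wpM2l ?exprn_ge0//.
  apply: (@le_trans _ _ (t * expR (- (a xi / 2 * t)))).
    apply: multiplier_le => //.
    rewrite ler_pdivlMr// mulrAC -expr2 ler_pdivrMr//.
    apply: (@le_trans _ _ (w xi ^+ 2));
      last by rewrite ler_peMr ?sqr_ge0// ler1n.
    by rewrite lerXn2r ?nnegrE// ltW.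
  rewrite ler_wpM2l ?(ltW t0)// ler_expR lerN2 mulrAC ler_wpM2r ?(ltW t0)//.
  by rewrite mulrAC ler_wpM2r.
rewrite ler_wpM2l ?(ltW t0)//; apply: le_trans (ler_norm _); apply: hM.
by rewrite (le_trans R0_ge1)// ltW.
Qed.

(** This is where n = 2 sigma is used: w^2 controls |xi|^n. *)
Lemma multiplier_high (t : R) k (xi : rV) : 0 < t -> R0 <= `|xi| ->
  2 ^+ k <= `|xi| ->
  multiplier w a t xi ^+ 2 <=
  2 / w0 ^+ 2 * (2 ^+ k) ^- n * expR (- (a1 * (2 `^ theta1) ^+ k * t)).
Proof.
move=> t0 Rxi kxi; have [wlow alow aw] := high Rxi; have xi0 := nz Rxi.
have ax := a_gt0 xi0; have wx := w_gt0 xi0.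
have two : 0 < 2 ^+ k :> R by rewrite exprn_gt0.
have nxi : 0 < `|xi| by rewrite normr_gt0.
apply: le_trans (multiplier_sqr_le wx ax t0 _) _.
  apply: (@le_trans _ _ (w xi ^+ 2)); first by rewrite lerXn2r ?nnegrE// ltW.
  by rewrite ler_peMl ?sqr_ge0// ler1n.
apply: ler_pM; rewrite ?expR_ge0 ?divr_ge0 ?sqr_ge0//.
  rewrite -mulrA ler_wpM2l//.
  rewrite -invfM lef_pV2 ?posrE ?mulr_gt0 ?exprn_gt0//.
  apply: (@le_trans _ _ (w0 ^+ 2 * `|xi| ^+ n)).
    by rewrite ler_wpM2l ?sqr_ge0// lerXn2r ?nnegrE// ltW.
  have -> : `|xi| ^+ n = (`|xi| `^ sigma) ^+ 2.
    by rewrite -!powR_mulrn ?powR_ge0// -powRrM n_sigma mulrC.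
  rewrite -exprMn lerXn2r ?nnegrE ?mulr_ge0 ?powR_ge0 ?(ltW w0_gt0) ?(ltW wx)//.
rewrite ler_expR lerN2 ler_wpM2r ?(ltW t0)//; apply: le_trans alow.
rewrite ler_wpM2l ?(ltW a1_gt0)// -powR_mulrn ?powR_ge0// -powRrM mulrC powRrM.
by rewrite powR_mulrn// ge0_ler_powR ?nnegrE ?(ltW theta1_gt0)// ltW.
Qed.

Lemma multiplier_annulus (r0 : R) : 0 < r0 ->
  exists2 d, 0 < d & forall t xi, 0 < t -> r0 <= `|xi| <= R0 ->
    multiplier w a t xi ^+ 2 <= 4 / d ^+ 2 * expR (- (d * t)).
Proof.
move=> r00.
have nz' (x : rV) : r0 <= `|x| <= R0 -> x != 0.
  by move=> /andP[x1 _]; rewrite -normr_gt0 (lt_le_trans r00).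
have cA := @compact_annulus R n r0 R0.
have [wm [wM [wm0 _ hw]]] := positive_bounds_on_compact cA
  (fun x h => w_cont (nz' x h)) (fun x h => w_gt0 (nz' x h)).
have [am [aM [am0 aM0 ha]]] := positive_bounds_on_compact cA
  (fun x h => a_cont (nz' x h)) (fun x h => a_gt0 (nz' x h)).
(* the two hypotheses of multiplier_le, uniformly on the annulus *)
pose d := Num.min (am / 2) (wm ^+ 2 / aM).
have d0 : 0 < d by rewrite lt_min !divr_gt0// exprn_gt0.
exists d => // t xi t0 xiA; have xi0 := nz' _ xiA.
have ax := a_gt0 xi0; have wx := w_gt0 xi0.
have /andP[w1 w2] := hw _ xiA; have /andP[b1 b2] := ha _ xiA.
apply: le_trans (t_exp_le t0 d0).
rewrite -(real_normK (num_real (multiplier _ _ _ _))).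
rewrite lerXn2r ?nnegrE ?mulr_ge0 ?expR_ge0 ?(ltW t0)//.
apply: multiplier_le => //.
- by rewrite ge_min ler_wpM2r.
- rewrite ge_min; apply/orP; right; apply: ler_pM.
  + exact: sqr_ge0.
  + by rewrite invr_ge0 ltW.
  + by rewrite lerXn2r ?nnegrE// ltW.
  + by rewrite lef_pV2 ?posrE.
Qed.

(** The ball of radius R0 contributes an exponentially small term, by
    [multiplier_annulus] and because 1 - chi vanishes near the origin; outside
    of it the dyadic sum gives the logarithm. *)
Lemma cutoff_multiplier_integral (chi : rV -> R[i]) :
  cmeasurable chi -> (exists M, forall x, Normc.normc (chi x) <= M) ->
  (\forall xi \near (0 : rV), chi xi = 1) ->
  exists B c : R, [/\ 0 < B, 0 < c & forall t, 0 < t ->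
    (\int[mu]_xi (sqn ((multiplier w a t xi)%:C - chi xi * (multiplier w a t
      xi)%:C))%:E <=
     (B * (1 + Num.max (- ln t) 0) * expR (- (c * t)))%:E)%E].
Proof.
move=> mchi [M chiM] chi1.
have [r0 r00 chir] : exists2 r0, 0 < r0 & forall xi : rV, `|xi| < r0 ->
  chi xi = 1.
  move/nbhs_normP: chi1 => [r /= r0 hr]; exists r => // xi xir.
  by apply: hr; rewrite /ball_ /= sub0r normrN.
have [d d0 hd] := multiplier_annulus r00.
have q1 : 1 < 2 `^ theta1 :> R.
  by rewrite /powR pnatr_eq0 /= expR_gt1 mulr_gt0// ln_gt0// ltr1n.
have [C2 [c2 [C20 c20 hsum]]] := dyadic_exp_sum q1 a1_gt0.
pose X := (1 + 2 * `|M|) ^+ 2.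
have X0 : 0 < X by rewrite exprn_gt0// ltr_pwDl// mulr_ge0.
have chiX xi : sqn (1 - chi xi) <= X.
  have -> : sqn (1 - chi xi) = Normc.normc (1 - chi xi) ^+ 2.
    by rewrite normc_sqrt sqr_sqrtr// sqn_ge0.
  rewrite lerXn2r ?nnegrE ?normc_ge0 ?addr_ge0 ?mulr_ge0//.
  rewrite (le_trans (normc_le _))// ReB ImB /= sub0r normrN.
  have := Re_le_normc (chi xi); have := Im_le_normc (chi xi).
  have := le_trans (chiM xi) (ler_norm _).
  have := ler_normB 1 (complex.Re (chi xi)); rewrite normr1; lra.
clearbody X.
have R00 : 0 <= R0 by rewrite (le_trans ler01).
pose P := X * (4 / d ^+ 2) * (2 * R0) ^+ n.
have P0 : 0 <= P.
  by rewrite mulr_ge0 ?exprn_ge0 ?mulr_ge0 ?(ltW X0)// invr_ge0 exprn_ge0// ltW.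
pose Q := X * (2 / w0 ^+ 2) * 4 ^+ n * C2.
have Q0 : 0 < Q by rewrite !mulr_gt0 ?invr_gt0 ?exprn_gt0.
exists (P + Q), (Num.min d c2); split;
  [by rewrite ltr_wpDl|by rewrite lt_min d0|].
move=> t t0; set L := Num.max _ _.
have L0 : 0 <= L by rewrite le_max lexx orbT.
have fE xi : sqn ((multiplier w a t xi)%:C - chi xi * (multiplier w a t
  xi)%:C) =
    sqn (1 - chi xi) * multiplier w a t xi ^+ 2.
  rewrite -[X in X - _]mul1r -mulrBl sqnM; congr (_ * _).
  by rewrite /sqn /= expr0n addr0.
under eq_integral => xi _ do rewrite fE.
have mf : measurable_fun setT (fun xi =>
  sqn (1 - chi xi) * multiplier w a t xi ^+ 2).
  apply: measurable_funM.
    by apply: measurable_sqn; apply: cmeasurableB => //; split;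
      exact: measurable_cst.
  by apply: measurable_funX; exact: measurable_multiplier_punctured.
apply: le_trans (dyadic_integral_le (A0 := X * (4 / d ^+ 2) * expR (- (d * t)))
  (X := X * (2 / w0 ^+ 2))
  (E := fun k => expR (- (a1 * (2 `^ theta1) ^+ k * t))) mf _ R0_ge1 _ _ _ _
    _) _.
- by move=> x; rewrite mulr_ge0 ?sqn_ge0 ?sqr_ge0.
- by rewrite !mulr_ge0 ?expR_ge0 ?(ltW X0)// invr_ge0 sqr_ge0.
- by rewrite !mulr_ge0 ?(ltW X0)// invr_ge0 sqr_ge0.
- by move=> k; exact: expR_ge0.
- move=> xi xiR; have [xir|rxi] := ltP `|xi| r0.
    rewrite chir// subrr /sqn /= expr0n addr0 mul0r.
    by rewrite !mulr_ge0 ?expR_ge0 ?(ltW X0)// invr_ge0 sqr_ge0.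
  rewrite -mulrA; apply: ler_pM; rewrite ?sqn_ge0 ?sqr_ge0//.
  by apply: hd => //; rewrite rxi.
- move=> k xi Rxi /andP[kxi _]; rewrite -(mulrA X) -(mulrA X).
  by apply: ler_pM; rewrite ?sqn_ge0 ?sqr_ge0 ?multiplier_high.
apply: le_trans (leeD2l _ (lee_wpmul2l _ (hsum t t0))) _.
  by rewrite lee_fin !mulr_ge0 ?exprn_ge0 ?(ltW X0)// invr_ge0 sqr_ge0.
rewrite -EFinM -EFinD lee_fin -/L.
have e1 : expR (- (d * t)) <= expR (- (Num.min d c2 * t)).
  by rewrite ler_expR lerN2 ler_wpM2r ?(ltW t0)// ge_min lexx.
have e2 : expR (- (c2 * t)) <= expR (- (Num.min d c2 * t)).
  by rewrite ler_expR lerN2 ler_wpM2r ?(ltW t0)// ge_min lexx orbT.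
rewrite (mulrDl P Q) [leRHS]mulrDl; apply: lerD.
  rewrite (mulrAC _ (expR _)) -/P; apply: (le_trans (ler_wpM2l P0 e1)).
  by rewrite ler_wpM2r ?expR_ge0// ler_peMr// lerDl.
rewrite (mulrA _ (C2 * _)) (mulrA _ C2) -/Q ler_wpM2l//.
by rewrite mulr_ge0 ?(ltW Q0)// addr_ge0.
Qed.

End HighFrequencyEstimate.

Theorem proposition1p2 (R : realType) (n : nat) (sigma : R)
    (w a : 'rV[R]_n -> R) (theta1 a1 C : R) (K : set 'rV[R]_n)
    (chi : 'rV[R]_n -> R[i])
    (n_ge1 : (1 <= n)%N) (sigma_gt0 : 0 < sigma) (n_sigma : n%:R = 2 * sigma)
    (w_smooth : smooth_on punctured w)
    (w_homogeneous : forall (r : R) (xi : 'rV[R]_n), 0 < r -> xi != 0 ->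
      w (r *: xi) = r `^ sigma * w xi)
    (w_rank : maximal_rank sigma w)
    (w_gt0 : forall xi : 'rV[R]_n, xi != 0 -> 0 < w xi)
    (a_Ck : Ck_on n.+1 punctured a)
    (a_gt0 : forall xi : 'rV[R]_n, xi != 0 -> 0 < a xi)
    (theta1_gt0 : 0 < theta1) (theta1_lt : theta1 < sigma)
    (a1_gt0 : 0 < a1) (C_gt0 : 0 < C)
    (K_compact : compact K)
    (a_lower : forall xi : 'rV[R]_n, xi != 0 -> ~ K xi ->
      a1 * enorm xi `^ theta1 <= a xi)
    (a_deriv : forall (g : 'I_n -> nat) (xi : 'rV[R]_n),
      (mi_order g <= n.+1)%N -> xi != 0 -> ~ K xi ->
      `|mi_partial g a xi| <= C * enorm xi `^ (theta1 - (mi_order g)%:R))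
    (chi_test : test_function chi)
    (chi_near0 : \forall xi \near (0 : 'rV[R]_n), chi xi = 1) :
  exists C' c : R, [/\ 0 < C', 0 < c &
    forall u1 : 'rV[R]_n -> R[i], cintegrable u1 ->
    forall t : R, 0 < t ->
    (L2norm_distr (fun phi =>
        solution w a u1 t phi - cutoff_distr chi (solution_hat w a u1 t) phi)%R
     <= (C' * (1 + Num.max (- ln t) 0) `^ (2^-1) * expR (- (c * t)))%:E
        * Lpnorm 1%E u1)%E].
Proof.
have cw (x : 'rV[R]_n) : x != 0 ->
  {for x, continuous w} by move: (w_smooth 0%N) => [+ _]; exact.
have ca (x : 'rV[R]_n) : x != 0 ->
  {for x, continuous a} by move: a_Ck => [+ _]; exact.
have au (xi : 'rV[R]_n) : xi != 0 -> ~ K xi ->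
  `|a xi| <= C * enorm xi `^ theta1.
  move=> xi0 nK; have := a_deriv (fun=> 0%N) xi;
    rewrite mi_partial0 /mi_order big1// subr0.
  exact.
have [R0 [w0 [R1 w00 high]]] := high_frequency_bounds theta1_gt0 theta1_lt
  a1_gt0 C_gt0
  K_compact cw w_homogeneous w_gt0 a_lower au.
have mchi : cmeasurable chi.
  by have [[s1 s2] _] := chi_test; split; apply: measurable_continuous_rV;
    exact: smooth_continuous.
have bchi := test_function_bounded chi_test.
have [B [c [B0 c0 hB]]] := cutoff_multiplier_integral n_sigma theta1_gt0 a1_gt0
  cw ca w_gt0 a_gt0 R1 w00 high mchi bchi chi_near0.
pose cn : R := ((2 * pi) ^+ n)^-1.
have cn0 : 0 < cn by rewrite invr_gt0 exprn_gt0// mulr_gt0// pi_gt0.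
exists (Num.sqrt (32 * cn * B)), (c / 2); split.
- by rewrite sqrtr_gt0 !mulr_gt0.
- by rewrite divr_gt0.
move=> u1 iu t t0; set L := 1 + _.
have L0 : 0 <= L by rewrite addr_ge0// le_max lexx orbT.
have -> : Num.sqrt (32 * cn * B) * L `^ 2^-1 * expR (- (c / 2 * t)) =
    Num.sqrt (32 * cn * (B * L * expR (- (c * t)))).
  have -> : expR (- (c * t)) = expR (- (c / 2 * t)) ^+ 2.
    by rewrite -expRM_natl; congr expR; field.
  set e := expR (- (c / 2 * t)).
  rewrite (_ : 32 * cn * (B * L * e ^+ 2) = 32 * cn * B * L * e ^+ 2);
    last by ring.
  rewrite powR12_sqrt// [RHS]sqrtrM;
    last by rewrite !mulr_ge0 ?(ltW cn0) ?(ltW B0).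
  rewrite sqrtr_sqr (ger0_norm (expR_ge0 _)); congr (_ * _).
  by rewrite [RHS]sqrtrM// !mulr_ge0 ?(ltW cn0) ?(ltW B0).
pose k1 xi := (multiplier w a t xi)%:C.
have ik1 : cintegrable k1.
  split; first exact: (@integrable_multiplier R n sigma theta1 a1 R0 w0 w a).
  exact: integrable0.
have [M chiM] := bchi.
have ik2 : cintegrable (fun xi =>
  chi xi * k1 xi) by exact: cintegrable_bounded_mul chiM ik1.
have := multiplier_L1_L2_bound ik1 ik2 iu (@schwartz_cintegrable R n) (hB t t0).
congr (L2norm_distr _ <= _)%E.
apply/funext => phi; congr (_ - _); rewrite /cutoff_distr /inv_fourier_distr.
by congr cintegral; apply/funext => xi; rewrite /solution_hat mulrA.
Qed.
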